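(* Let $k$ be a field and let $A=kQ/I$ be a finite-dimensional monomial algebra over $k$. Let $E_A$ be the (symmetric) fractional Brauer configuration of type S associated with $A$, let $A_E=kQ_{E_A}/I_{E_A}$ be the symmetric fractional Brauer configuration algebra of type S of $E_A$, and let $T(A)=A\rtimes D(A)$ be the trivial extension of $A$ by $D(A)=\mathrm{Hom}_k(A,k)$. Then $A_E$ is isomorphic to $T(A)$ (as $k$-algebras).
   Context: Paths are written from right to left; $s(p),t(p),l(p)$ denote the source, target and length of a path $p$; a subpath consists of consecutive arrows. **Monomial algebras.** $Q$ is a finite quiver, $I$ is an ideal of $kQ$ generated by paths, contained in the ideal $kQ_{\ge 1}$ generated by the arrows and containing some power of $kQ_{\geq 1}$. A maximal path of $A=kQ/I$ is a path $p\notin I$ such that $\alpha p=0=p\alpha$ in $A$ for every arrow $\alpha\in Q_1$; $\mathcal M$ is the set of maximal paths. **Trivial extension.** $T(A)$ is the vector space $A\oplus D(A)$ with multiplication $(a,f)(b,h)=(ab,ah+fb)$, where $D(A)$ is the $A$-$A$-bimodule with $(afb)(x)=f(bxa)$. **f-BC.** A fractional Brauer configuration (f-BC) is a quadruple $E=(E,P,L,d)$ where $E$ is a $G$-set for $G=\langle g\rangle\cong(\mathbb Z,+)$, $P$ and $L$ are partitions of $E$ ($P(e)$, $L(e)$ denote the classes containing $e$), and $d:E\to\mathbb Z_{+}$ is a function to the positive integers, such that: (f1) $L(e)\subseteq P(e)$ and $P(e)$ is finite for each $e$; (f2) $L(e_1)=L(e_2)$ implies $P(g(e_1))=P(g(e_2))$;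 (f3) $d$ is constant on $\langle g\rangle$-orbits; (f4) $P(e_1)=P(e_2)$ iff $P(g^{d(e_1)}(e_1))=P(g^{d(e_2)}(e_2))$; (f5) $L(e_1)=L(e_2)$ iff $L(g^{d(e_1)}(e_1))=L(g^{d(e_2)}(e_2))$; (f6) for all $e,h\in E$ the formal sequence $L(g^{d(e)-1}(e))\cdots L(g(e))L(e)$ is not a proper subsequence (of consecutive terms) of $L(g^{d(h)-1}(h))\cdots L(g(h))L(h)$. Elements of $E$ are called angles. $E$ is symmetric if $g^{d(e)}(e)=e$ for all $e\in E$. **Associated quiver and algebra.** $Q_E$ has vertices the classes $P(e)$ and arrows the classes $L(e)$, where $L(e)$ goes from $P(e)$ to $P(g(e))$. $I_E$ is the ideal of $kQ_E$ generated by: (R1) $L(g^{d(e)-1-j}(e))\cdots L(g(e))L(e)-L(g^{d(h)-1-j}(h))\cdots L(g(h))L(h)$, if $P(e)=P(h)$, $j\ge 0$ (with $j<d(e)$, $j<d(h)$ so that the expression makes sense), and $L(g^{d(e)-i}(e))=L(g^{d(h)-i}(h))$ for $1\le i\le j$; (R2) $L(e_n)\cdots L(e_2)L(e_1)$, if $P(g(e_i))=P(e_{i+1})$ for $1\le i\le n-1$ and $\bigcap_{i=1}^n g^{n-i}(L(e_i))=\emptyset$; (R3) $L(g^{n-1}(e))\cdots L(g(e))L(e)$ for $n>d(e)$. The algebra $kQ_E/I_E$ is the fractional Brauer configuration algebra of $E$. **Type S.** A standard sequence is $p=(g^{n-1}(e),\dots,g(e),e)$ with $e\in E$, $0\le n\le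 d(e)$ (for $n=0$ the trivial sequence $()_e$). Put ${}^\wedge p=(g^{d(e)-1}(e),\dots,g^n(e))$ if $0<n<d(e)$, ${}^\wedge p=()_{g^{d(e)}(e)}$ if $n=d(e)$, ${}^\wedge p=(g^{d(e)-1}(e),\dots,e)$ if $n=0$; and $p^\wedge=(g^{-1}(e),\dots,g^{n-d(e)}(e))$ if $0<n<d(e)$, $p^\wedge=()_e$ if $n=d(e)$, $p^\wedge=(g^{-1}(e),\dots,g^{-d(e)}(e))$ if $n=0$. Put $L(p)=L(g^{n-1}(e))\cdots L(e)$ for $n>0$ and $L(()_e)=e_{P(e)}$ (the trivial path at $P(e)$). Write $p\equiv q$ if $L(p)=L(q)$. For a set $\mathcal X$ of standard sequences (a single sequence being viewed as a one-element set), $[\mathcal X]$ is the set of standard sequences $q$ with $q\equiv p$ for some $p\in\mathcal X$, and ${}^\wedge\mathcal X=\{{}^\wedge p\mid p\in\mathcal X\}$, $\mathcal X^\wedge=\{p^\wedge\mid p\in\mathcal X\}$. An f-BC is of type S (an $f_s$-BC) if: (f7) $p\equiv q$ implies $[[{}^\wedge p]^\wedge]=[[{}^\wedge q]^\wedge]$. Its algebra is then called an $f_s$-BCA; it is called symmetric if $E$ is finite and symmetric. **The configuration $E_A=(E,P,L,d)$ of a monomial algebra $A$.** $E$ consists of all $(e_i,p)$ with $p=(e_1\to e_2\to\cdots\to e_n)\in\mathcal M$ and $1\le i\le n$, where $e_i$ is the $i$-th vertex passed by $p$ (so $n=l(p)+1$); $(e_i,p)$ and $(e_j,p)$ with $i\ne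 j$ are distinct angles even if $e_i=e_j$ in $Q_0$. $P((e_i,p))=\{(e'_j,p')\in E\mid e'_j=e_i\text{ in }Q_0\}$. For $i<n$, $L((e_i,p))$ is the set of $(e'_j,p')$ such that the arrow of $p'$ starting at position $j$ equals the arrow of $p$ starting at position $i$; for the last position, $L((e_n,p))=\{(e_n,p)\}$. $d((e_i,p))=l(p)+1$. $g((e_i,p))=(e_{i+1},p)$ for $i<n$ and $g((e_n,p))=(e_1,p)$. *)

(* Defs.v *)
From HB Require Import structures.
From mathcomp Require Import all_boot fingroup perm ssralg poly generic_quotient.
From mathcomp Require Import boolp classical_sets functions.
From mathcomp Require Import finmap monalg.

Set Implicit Arguments.
Unset Strict Implicit.
Unset Printing Implicit Defensive.

Import GRing.Theory.
Local Open Scope ring_scope.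
Local Open Scope quotient_scope.

(* The library's [algType] requires [1 != 0]. The empty quiver, whose path
   algebra is zero, is not excluded here, so unital associative algebras that
   may be zero are needed. *)
Record pzAlgType (k : pzRingType) := PzAlg {
  pz_lmod : lmodType k;
  pz_one : pz_lmod;
  pz_mul : pz_lmod -> pz_lmod -> pz_lmod;
  pz_mulA : associative pz_mul;
  pz_mul1r : left_id pz_one pz_mul;
  pz_mulr1 : right_id pz_one pz_mul;
  pz_mulDl : left_distributive pz_mul +%R;
  pz_mulDr : right_distributive pz_mul +%R;
  pz_mulZl : forall c x y, c *: pz_mul x y = pz_mul (c *: x) y;
  pz_mulZr : forall c x y, c *: pz_mul x y = pz_mul x (c *: y) }.

Definition pz_sort (k : pzRingType) (A : pzAlgType k) : Type := pz_lmod A.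
Coercion pz_sort : pzAlgType >-> Sortclass.

HB.instance Definition _ (k : pzRingType) (A : pzAlgType k) :=
  GRing.Lmodule.on (pz_sort A).
HB.instance Definition _ (k : pzRingType) (A : pzAlgType k) :=
  GRing.Zmodule_isPzRing.Build (pz_sort A)
    (@pz_mulA k A) (@pz_mul1r k A) (@pz_mulr1 k A)
    (@pz_mulDl k A) (@pz_mulDr k A).

Lemma pz_scalerAl (k : pzRingType) (A : pzAlgType k) (c : k) (x y : A) :
  c *: (x * y) = (c *: x) * y.
Proof. exact: pz_mulZl. Qed.
Lemma pz_scalerAr (k : pzRingType) (A : pzAlgType k) (c : k) (x y : A) :
  c *: (x * y) = x * (c *: y).
Proof. exact: pz_mulZr. Qed.

Definition alg_isomorphic (k : pzRingType) (A B : pzAlgType k) : Prop :=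
  exists f : {rmorphism A -> B}, scalable f /\ bijective f.

(******************************************************************************)

Section Ideals.
Variables (k : pzRingType) (A : pzAlgType k).
Local Open Scope classical_set_scope.

Definition two_sided_ideal (J : set A) : Prop :=
  [/\ J 0, (forall x y, J x -> J y -> J (x + y))
    & (forall a x b, J x -> J (a * x * b))].

Record ideal := Ideal {
  ideal_set :> A -> Prop;
  idealP : two_sided_ideal ideal_set }.

Lemma ideal0 (J : ideal) : J 0. Proof. by case: (idealP J). Qed.
Lemma idealD (J : ideal) x y : J x -> J y -> J (x + y).
Proof. by case: (idealP J) => _ + _; apply. Qed.
Lemma idealM (J : ideal) a x b : J x -> J (a * x * b).
Proof. by case: (idealP J) => _ _; apply. Qed.
Lemma idealMl (J : ideal) a x : J x -> J (a * x).
Proof. by move=> Jx; rewrite -[a * x]mulr1; apply: idealM. Qed.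
Lemma idealMr (J : ideal) x b : J x -> J (x * b).
Proof. by move=> Jx; rewrite -[x]mul1r; apply: idealM. Qed.
Lemma idealN (J : ideal) x : J x -> J (- x).
Proof. by move=> Jx; rewrite -mulN1r; apply: idealMl. Qed.
Lemma idealB (J : ideal) x y : J x -> J y -> J (x - y).
Proof. by move=> Jx Jy; apply: idealD => //; apply: idealN. Qed.
Lemma idealZ (J : ideal) c x : J x -> J (c *: x).
Proof. by move=> Jx; rewrite -[x]mul1r pz_scalerAl; apply: idealMl. Qed.

Lemma smallest_two_sided_ideal (S : set A) :
  two_sided_ideal (smallest two_sided_ideal S).
Proof.
split.
- by move=> J [[J0 _ _] _].
- by move=> x y Jx Jy J HJ; case: (HJ) => -[_ JD _] _; apply: JD; [exact: Jx|exact: Jy].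
- by move=> a x b Jx J HJ; case: (HJ) => -[_ _ JM] _; apply: JM; exact: Jx.
Qed.

Definition gen_ideal (S : set A) : ideal := Ideal (smallest_two_sided_ideal S).

Lemma mem_gen_ideal (S : set A) x : S x -> gen_ideal S x.
Proof. exact: sub_gen_smallest. Qed.

Fixpoint ideal_exp (J : ideal) (n : nat) : ideal :=
  if n is n'.+1 then
    gen_ideal [set z | exists x y, [/\ ideal_exp J n' x, J y & z = x * y]]
  else gen_ideal setT.

End Ideals.

Section QuotientAlgebra.
Variables (k : pzRingType) (A : pzAlgType k) (J : ideal A).

Definition congr_mod (x y : A) : bool := `[< J (x - y) >].

Lemma congr_mod_equiv : equiv_class_of congr_mod.
Proof.
split=> [x|x y|y x z].
- by apply/asboolP; rewrite subrr; apply: ideal0.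
- by apply/asboolP/asboolP => /idealN; rewrite opprB.
- move=> /asboolP h1 /asboolP h2; apply/asboolP.
  by rewrite -[x](addrNK y) -addrA; apply: idealD.
Qed.

Canonical congr_mod_equivRel := EquivRelPack congr_mod_equiv.
Canonical congr_mod_encModRel := defaultEncModRel congr_mod.

Definition quot_car := {eq_quot congr_mod}.

HB.instance Definition _ : EqQuotient A congr_mod quot_car :=
  EqQuotient.on quot_car.
HB.instance Definition _ := Choice.on quot_car.

Definition quot_pi (x : A) : quot_car := \pi_quot_car x.

Lemma quot_piP x y : quot_pi x = quot_pi y <-> J (x - y).
Proof.
split=> [/eqP|h]; first by rewrite piE => /asboolP.
by apply/eqP; rewrite piE; apply/asboolP.
Qed.

Lemma quot_pi_surj (u : quot_car) : exists x, u = quot_pi x.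
Proof. by exists (repr u); rewrite /quot_pi reprK. Qed.

Lemma repr_quot_pi x : J (repr (quot_pi x) - x).
Proof. by apply/quot_piP; rewrite /quot_pi reprK. Qed.

Definition quot_add (u v : quot_car) := quot_pi (repr u + repr v).
Definition quot_opp (u : quot_car) := quot_pi (- repr u).
Definition quot_mul (u v : quot_car) := quot_pi (repr u * repr v).
Definition quot_scale (c : k) (u : quot_car) := quot_pi (c *: repr u).

Lemma quot_addE x y : quot_add (quot_pi x) (quot_pi y) = quot_pi (x + y).
Proof.
apply/quot_piP; rewrite opprD addrACA.
by apply: idealD; apply: repr_quot_pi.
Qed.
Lemma quot_oppE x : quot_opp (quot_pi x) = quot_pi (- x).
Proof. by apply/quot_piP; rewrite -opprD; apply/idealN/repr_quot_pi. Qed.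
Lemma quot_mulE x y : quot_mul (quot_pi x) (quot_pi y) = quot_pi (x * y).
Proof.
apply/quot_piP; set x' := repr _; set y' := repr _.
have -> : x' * y' - x * y = (x' - x) * y' + x * (y' - y).
  by rewrite mulrBl mulrBr addrA subrK.
by apply: idealD; [apply/idealMr/repr_quot_pi | apply/idealMl/repr_quot_pi].
Qed.
Lemma quot_scaleE c x : quot_scale c (quot_pi x) = quot_pi (c *: x).
Proof. by apply/quot_piP; rewrite -scalerBr; apply/idealZ/repr_quot_pi. Qed.

Local Definition quotE := (quot_addE, quot_oppE, quot_mulE, quot_scaleE).

Lemma quot_addA : associative quot_add.
Proof.
move=> u v w; have [x ->] := quot_pi_surj u; have [y ->] := quot_pi_surj v.
by have [z ->] := quot_pi_surj w; rewrite !quotE addrA.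
Qed.
Lemma quot_addC : commutative quot_add.
Proof.
move=> u v; have [x ->] := quot_pi_surj u; have [y ->] := quot_pi_surj v.
by rewrite !quotE addrC.
Qed.
Lemma quot_add0 : left_id (quot_pi 0) quot_add.
Proof. by move=> u; have [x ->] := quot_pi_surj u; rewrite !quotE add0r. Qed.
Lemma quot_addN : left_inverse (quot_pi 0) quot_opp quot_add.
Proof. by move=> u; have [x ->] := quot_pi_surj u; rewrite !quotE addNr. Qed.

HB.instance Definition _ :=
  GRing.isZmodule.Build quot_car quot_addA quot_addC quot_add0 quot_addN.

Lemma quot_addE' x y : quot_pi x + quot_pi y = quot_pi (x + y).
Proof. exact: quot_addE. Qed.
Local Definition quotE' := (quot_addE', quotE).

Lemma quot_mulA : associative quot_mul.
Proof.
move=> u v w; have [x ->] := quot_pi_surj u; have [y ->] := quot_pi_surj v.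
by have [z ->] := quot_pi_surj w; rewrite !quotE mulrA.
Qed.
Lemma quot_mul1 : left_id (quot_pi 1) quot_mul.
Proof. by move=> u; have [x ->] := quot_pi_surj u; rewrite !quotE mul1r. Qed.
Lemma quot_1mul : right_id (quot_pi 1) quot_mul.
Proof. by move=> u; have [x ->] := quot_pi_surj u; rewrite !quotE mulr1. Qed.
Lemma quot_mulDl : left_distributive quot_mul +%R.
Proof.
move=> u v w; have [x ->] := quot_pi_surj u; have [y ->] := quot_pi_surj v.
have [z ->] := quot_pi_surj w.
by rewrite !quotE' mulrDl.
Qed.
Lemma quot_mulDr : right_distributive quot_mul +%R.
Proof.
move=> u v w; have [x ->] := quot_pi_surj u; have [y ->] := quot_pi_surj v.
have [z ->] := quot_pi_surj w.
by rewrite !quotE' mulrDr.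
Qed.

Lemma quot_scaleA a b u : quot_scale a (quot_scale b u) = quot_scale (a * b) u.
Proof. by have [x ->] := quot_pi_surj u; rewrite !quotE scalerA. Qed.
Lemma quot_scale1 : left_id 1 quot_scale.
Proof. by move=> u; have [x ->] := quot_pi_surj u; rewrite !quotE scale1r. Qed.
Lemma quot_scaleDr : right_distributive quot_scale +%R.
Proof.
move=> c u v; have [x ->] := quot_pi_surj u; have [y ->] := quot_pi_surj v.
by rewrite !quotE' scalerDr.
Qed.
Lemma quot_scaleDl u : {morph quot_scale^~ u : a b / a + b}.
Proof.
by move=> a b; have [x ->] := quot_pi_surj u; rewrite !quotE' scalerDl.
Qed.

HB.instance Definition _ := GRing.Zmodule_isLmodule.Build k quot_car
  quot_scaleA quot_scale1 quot_scaleDr quot_scaleDl.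

Lemma quot_scaleE' c x : c *: quot_pi x = quot_pi (c *: x).
Proof. exact: quot_scaleE. Qed.

Lemma quot_scaleAl (c : k) (u v : quot_car) :
  c *: quot_mul u v = quot_mul (c *: u) v.
Proof.
have [x ->] := quot_pi_surj u; have [y ->] := quot_pi_surj v.
by rewrite !(quot_scaleE', quotE) pz_scalerAl.
Qed.
Lemma quot_scaleAr (c : k) (u v : quot_car) :
  c *: quot_mul u v = quot_mul u (c *: v).
Proof.
have [x ->] := quot_pi_surj u; have [y ->] := quot_pi_surj v.
by rewrite !(quot_scaleE', quotE) pz_scalerAr.
Qed.

Definition quot_alg : pzAlgType k := PzAlg quot_mulA quot_mul1 quot_1mul
  quot_mulDl quot_mulDr quot_scaleAl quot_scaleAr.

Definition quot_proj (x : A) : quot_alg := quot_pi x.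

Lemma quot_proj_is_zmod_morphism : zmod_morphism quot_proj.
Proof.
move=> x y; apply: esym.
rewrite -[LHS]/(quot_add (quot_pi x) (quot_opp (quot_pi y))).
by rewrite !quotE.
Qed.
HB.instance Definition _ :=
  GRing.isZmodMorphism.Build A quot_alg quot_proj quot_proj_is_zmod_morphism.
Lemma quot_proj_is_monoid_morphism : monoid_morphism quot_proj.
Proof. by split=> [//|x y]; apply: esym; exact: quot_mulE. Qed.
HB.instance Definition _ :=
  GRing.isMonoidMorphism.Build A quot_alg quot_proj quot_proj_is_monoid_morphism.

Lemma quot_projZ : scalable quot_proj.
Proof. by move=> c x; apply: esym; exact: quot_scaleE. Qed.

Lemma quot_projP x y : quot_proj x = quot_proj y <-> J (x - y).
Proof. exact: quot_piP. Qed.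
Lemma quot_proj_surj (u : quot_alg) : exists x, u = quot_proj x.
Proof. exact: quot_pi_surj. Qed.

End QuotientAlgebra.

Arguments quot_proj {k A} J x.

(******************************************************************************)

Section TrivialExtension.
Variables (k : comPzRingType) (A : pzAlgType k).

Definition linear_pred : {pred A -> k^o} := fun f => `[< linear f >].

Record dual := Dual {
  dual_fun :> A -> k^o;
  dual_fun_linear : dual_fun \in linear_pred }.
HB.instance Definition _ := [isSub for dual_fun].
HB.instance Definition _ := [Choice of dual by <:].

Lemma linear_pred_subsemimod_closed : GRing.subsemimod_closed linear_pred.
Proof.
split; first split.
- by apply/asboolP => c x y /=; rewrite scaler0 addr0.
- move=> f g /asboolP lf /asboolP lg; apply/asboolP => c x y.
  by rewrite !fctE lf lg scalerDr addrACA.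
- move=> a f /asboolP lf; apply/asboolP => c x y.
  by rewrite !fctE lf scalerDr !scalerA mulrC.
Qed.

HB.instance Definition _ :=
  GRing.SubChoice_isSubLmodule.Build k (A -> k^o) linear_pred dual
    linear_pred_subsemimod_closed.

Lemma dual_linear (f : dual) : linear f.
Proof. by apply/asboolP; apply: (valP f). Qed.

Lemma dualP (f g : dual) : (forall x, f x = g x) -> f = g.
Proof. by move=> fg; apply: val_inj; apply/funext. Qed.
Lemma dual_addE (f g : dual) x : (f + g) x = f x + g x.
Proof. by []. Qed.
Lemma dual_scaleE c (f : dual) x : (c *: f) x = c *: f x.
Proof. by []. Qed.
Lemma dualD (f : dual) x y : f (x + y) = f x + f y.
Proof. by have := dual_linear f 1 x y; rewrite !scale1r. Qed.
Lemma dualZ (f : dual) c x : f (c *: x) = c *: f x.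
Proof.
have f0 : f 0 = 0.
  by apply: (addrI (f 0)); rewrite -dualD !addr0.
by have := dual_linear f c x 0; rewrite !addr0 f0 addr0.
Qed.

(* the bimodule structure (a f b)(x) = f (b x a) *)
Lemma dual_actP (a : A) (f : dual) (b : A) :
  (fun x => f (b * x * a)) \in linear_pred.
Proof.
apply/asboolP => c x y.
by rewrite mulrDr mulrDl dualD -pz_scalerAr -pz_scalerAl dualZ.
Qed.
Definition dual_act (a : A) (f : dual) (b : A) : dual :=
  Dual (dual_actP a f b).

Lemma dual_actE a f b x : dual_act a f b x = f (b * x * a).
Proof. by []. Qed.

Definition trivial_ext_car := (A * dual)%type.
HB.instance Definition _ := GRing.Lmodule.on trivial_ext_car.

Definition trivial_ext_mul (x y : trivial_ext_car) : trivial_ext_car :=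
  (x.1 * y.1, dual_act x.1 y.2 1 + dual_act 1 x.2 y.1).
Definition trivial_ext_one : trivial_ext_car := (1, 0).

Lemma trivial_ext_mulA : associative trivial_ext_mul.
Proof.
move=> x y z; rewrite /trivial_ext_mul /= mulrA; congr pair.
apply: dualP => u.
by rewrite !(dual_addE, dual_actE) ?mul1r ?mulr1 !mulrA addrA.
Qed.
Lemma trivial_ext_mul1 : left_id trivial_ext_one trivial_ext_mul.
Proof.
move=> [a f]; rewrite /trivial_ext_mul /= mul1r; congr pair; apply: dualP => u.
by rewrite !(dual_addE, dual_actE) mul1r mulr1 addr0.
Qed.
Lemma trivial_ext_1mul : right_id trivial_ext_one trivial_ext_mul.
Proof.
move=> [a f]; rewrite /trivial_ext_mul /= mulr1; congr pair; apply: dualP => u.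
by rewrite !(dual_addE, dual_actE) mul1r mulr1 add0r.
Qed.
Lemma trivial_ext_mulDl : left_distributive trivial_ext_mul +%R.
Proof.
move=> x y z; rewrite /trivial_ext_mul /= mulrDl; congr pair; apply: dualP => u.
rewrite !(dual_addE, dual_actE) mulrDr dualD !mulr1.
by rewrite addrACA.
Qed.
Lemma trivial_ext_mulDr : right_distributive trivial_ext_mul +%R.
Proof.
move=> x y z; rewrite /trivial_ext_mul /= mulrDr; congr pair; apply: dualP => u.
rewrite !(dual_addE, dual_actE) mulrDl mulrDl dualD.
by rewrite addrACA.
Qed.

Lemma trivial_ext_scaleAl c (x y : trivial_ext_car) : 
  c *: trivial_ext_mul x y = trivial_ext_mul (c *: x) y.
Proof.
congr pair; first exact: pz_scalerAl.
apply: dualP => u.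
rewrite -[LHS]/(c *: (y.2 (1 * u * x.1) + x.2 (y.1 * u * 1))).
rewrite -[RHS]/(y.2 (1 * u * (c *: x.1)) + c *: x.2 (y.1 * u * 1)).
by rewrite -pz_scalerAr dualZ scalerDr.
Qed.
Lemma trivial_ext_scaleAr c (x y : trivial_ext_car) : 
  c *: trivial_ext_mul x y = trivial_ext_mul x (c *: y).
Proof.
congr pair; first exact: pz_scalerAr.
apply: dualP => u.
rewrite -[LHS]/(c *: (y.2 (1 * u * x.1) + x.2 (y.1 * u * 1))).
rewrite -[RHS]/(c *: y.2 (1 * u * x.1) + x.2 (c *: y.1 * u * 1)).
by rewrite -!pz_scalerAl dualZ scalerDr.
Qed.

Definition trivial_ext : pzAlgType k := PzAlg trivial_ext_mulA
  trivial_ext_mul1 trivial_ext_1mul trivial_ext_mulDl trivial_ext_mulDr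
  trivial_ext_scaleAl trivial_ext_scaleAr.

End TrivialExtension.

(******************************************************************************)

Record quiver := Quiver {
  vertex : finType;
  arrow : finType;
  arrow_src : arrow -> vertex;
  arrow_tgt : arrow -> vertex }.

Section Paths.
Variable Q : quiver.

Fixpoint composable (v : vertex Q) (s : seq (arrow Q)) : bool :=
  if s is a :: s' then (arrow_src a == v) && composable (arrow_tgt a) s'
  else true.

(* A path is its source together with the list of its arrows in the order in
   which they are traversed, i.e. the right-to-left word read backwards. *)
Record qpath := QPath {
  qpath_val : vertex Q * seq (arrow Q);
  qpath_valP : composable qpath_val.1 qpath_val.2 }.
HB.instance Definition _ := [isSub for qpath_val].
HB.instance Definition _ := [Choice of qpath by <:].

Definition psrc (p : qpath) : vertex Q := (qpath_val p).1.
Definition parrows (p : qpath) : seq (arrow Q) := (qpath_val p).2.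
Definition plen (p : qpath) : nat := size (parrows p).
Definition pvertices (p : qpath) : seq (vertex Q) :=
  psrc p :: [seq arrow_tgt a | a <- parrows p].
Definition ptgt (p : qpath) : vertex Q := last (psrc p) (map (@arrow_tgt Q) (parrows p)).

Definition pvertex (v : vertex Q) : qpath := @QPath (v, [::]) isT.

Lemma parrow_subproof (a : arrow Q) : composable (arrow_src a) [:: a].
Proof. by rewrite /= eqxx. Qed.
Definition parrow (a : arrow Q) : qpath :=
  @QPath (arrow_src a, [:: a]) (parrow_subproof a).

(* [pcomp q p] is the path [q p]: first [p], then [q]. *)
Definition pcomp (q p : qpath) : option qpath :=
  if ptgt p == psrc q then insub (psrc p, parrows p ++ parrows q) else None.

Lemma composable_cat v s1 s2 : composable v (s1 ++ s2) =
  composable v s1 && composable (last v (map (@arrow_tgt Q) s1)) s2.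
Proof. by elim: s1 v => //= a s1 IH v; rewrite IH andbA. Qed.

Lemma pcomp_val (q p : qpath) : omap qpath_val (pcomp q p) =
  if ptgt p == psrc q then Some (psrc p, parrows p ++ parrows q) else None.
Proof.
rewrite /pcomp; case: ifP => // /eqP e; case: insubP => [r _ rE|] /=.
  by rewrite -[qpath_val r]/(val r) rE.
rewrite composable_cat (valP p) /= -[last (psrc p) _]/(ptgt p) e.
by rewrite (valP q).
Qed.

Lemma pcomp_some (q p : qpath) : ptgt p = psrc q ->
  exists2 r, pcomp q p = Some r & qpath_val r = (psrc p, parrows p ++ parrows q).
Proof.
move=> e; have := pcomp_val q p; rewrite e eqxx.
by case: (pcomp q p) => //= r [<-]; exists r.
Qed.

Lemma pcomp_none (q p : qpath) : ptgt p != psrc q -> pcomp q p = None.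
Proof. by rewrite /pcomp => /negbTE ->. Qed.

Lemma pcompA (r q p : qpath) :
  obind (pcomp r) (pcomp q p) = obind (fun x => pcomp x p) (pcomp r q).
Proof.
have tgtE (x y z : qpath) : qpath_val z = (psrc x, parrows x ++ parrows y) ->
    ptgt x = psrc y -> ptgt z = ptgt y /\ psrc z = psrc x.
  move=> e exy; split; last by rewrite /psrc e.
  rewrite {1}/ptgt /parrows /psrc e /= map_cat last_cat.
  by rewrite -[last (psrc x) _]/(ptgt x) exy.
have [epq|npq] := eqVneq (ptgt p) (psrc q); last first.
  rewrite (pcomp_none npq) /=.
  have [eqr|nqr] := eqVneq (ptgt q) (psrc r); last by rewrite pcomp_none.
  have [x -> xE] /= := pcomp_some eqr.
  by rewrite pcomp_none //; have [_ ->] := tgtE _ _ _ xE eqr.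
have [y -> yE] /= := pcomp_some epq; have [ty sy] := tgtE _ _ _ yE epq.
have [eqr|nqr] := eqVneq (ptgt q) (psrc r); last first.
  by rewrite (pcomp_none nqr) /= pcomp_none ?ty.
have [x -> xE] /= := pcomp_some eqr; have [tx sx] := tgtE _ _ _ xE eqr.
have [u -> uE] := @pcomp_some r y (etrans ty eqr).
have [w -> wE] := @pcomp_some x p (etrans epq (esym sx)).
congr Some; apply: val_inj; rewrite /= uE wE.
by rewrite /parrows /psrc xE yE /= catA.
Qed.

Lemma pcomp_id_r p v : pcomp p (pvertex v) = if v == psrc p then Some p else None.
Proof.
rewrite /pcomp /ptgt /=; case: eqP => // ->.
rewrite -[(_, _)]/(psrc p, parrows p) -surjective_pairing.
by rewrite -[qpath_val p]/(val p) valK.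
Qed.

Lemma pcomp_id_l p v : pcomp (pvertex v) p = if v == ptgt p then Some p else None.
Proof.
rewrite /pcomp /= eq_sym; case: eqP => // _; rewrite cats0.
by rewrite -surjective_pairing -[qpath_val p]/(val p) valK.
Qed.

End Paths.

Section BilinearExtension.
Variables (k : pzRingType) (V : lmodType k) (Q : quiver).
Variables (e : qpath Q -> V) (mul : V -> V -> V).
Hypothesis V_ind : forall P : V -> Prop, P 0 ->
  (forall c p x, P x -> P (c *: e p + x)) -> forall x, P x.
Hypotheses (mulDl : left_distributive mul +%R)
           (mulDr : right_distributive mul +%R).
Hypotheses (mul0 : forall x, mul 0 x = 0) (mulx0 : forall x, mul x 0 = 0).
Hypotheses (mulZl : forall c x y, c *: mul x y = mul (c *: x) y)
           (mulZr : forall c x y, c *: mul x y = mul x (c *: y)).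
Hypothesis mulU : forall q p,
  mul (e q) (e p) = if pcomp q p is Some r then e r else 0.

Lemma bilin_mulA : associative mul.
Proof.
have mb r q p : mul (e r) (mul (e q) (e p)) = mul (mul (e r) (e q)) (e p).
  rewrite !mulU; have := pcompA r q p.
  case: (pcomp q p) => [x|]; case: (pcomp r q) => [y|] /= h.
  - by rewrite !mulU h.
  - by rewrite mulU h mul0.
  - by rewrite mulU -h mulx0.
  - by rewrite mulx0 mul0.
have mb2 r q z : mul (e r) (mul (e q) z) = mul (mul (e r) (e q)) z.
  elim/V_ind: z => [|c p z IH]; first by rewrite !mulx0.
  by rewrite !mulDr IH -!mulZr mb.
have mb3 r y z : mul (e r) (mul y z) = mul (mul (e r) y) z.
  elim/V_ind: y => [|c p y IH]; first by rewrite mul0 mulx0 mul0.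
  rewrite mulDl !mulDr mulDl IH; congr (_ + _).
  by rewrite -mulZl -!mulZr -mulZl mb2.
move=> x y z; elim/V_ind: x => [|c p x IH]; first by rewrite !mul0.
by rewrite !mulDl IH -!mulZl mb3.
Qed.

Lemma bilin_mul1r : left_id (\sum_(v : vertex Q) e (pvertex v)) mul.
Proof.
have sumE (r : seq (vertex Q)) F y :
    mul (\sum_(i <- r) F i) y = \sum_(i <- r) mul (F i) y.
  by apply: (big_morph (mul^~ y)) => [u v|]; rewrite ?mulDl ?mul0.
move=> x; elim/V_ind: x => [|c p x IH]; first exact: mulx0.
rewrite mulDr -mulZr IH sumE (bigD1 (ptgt p)) //= big1 => [|v nv].
  by rewrite addr0 mulU pcomp_id_l eqxx.
by rewrite mulU pcomp_id_l (negbTE nv).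
Qed.

Lemma bilin_mulr1 : right_id (\sum_(v : vertex Q) e (pvertex v)) mul.
Proof.
have sumE (r : seq (vertex Q)) F y :
    mul y (\sum_(i <- r) F i) = \sum_(i <- r) mul y (F i).
  by apply: (big_morph (mul y)) => [u v|]; rewrite ?mulDr ?mulx0.
move=> x; elim/V_ind: x => [|c p x IH]; first exact: mul0.
rewrite mulDl -mulZl IH sumE (bigD1 (psrc p)) //= big1 => [|v nv].
  by rewrite addr0 mulU pcomp_id_r eqxx.
by rewrite mulU pcomp_id_r (negbTE nv).
Qed.

End BilinearExtension.

Definition path_mul_basis (k : fieldType) (Q : quiver) (q p : qpath Q) :
    {malg k[qpath Q]} :=
  if pcomp q p is Some r then << r >> else 0.

(* Locked, as otherwise unification unfolds finitely supported functions. *)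
HB.lock Definition path_mul (k : fieldType) (Q : quiver)
    (x y : {malg k[qpath Q]}) : {malg k[qpath Q]} :=
  \sum_(q <- msupp x) \sum_(p <- msupp y) (x@_q * y@_p) *: path_mul_basis k q p.
Canonical path_mul_unlockable := Unlockable path_mul.unlock.

HB.lock Definition path_one (k : fieldType) (Q : quiver) : {malg k[qpath Q]} :=
  \sum_(v : vertex Q) << pvertex v >>.
Canonical path_one_unlockable := Unlockable path_one.unlock.

HB.lock Definition path_basis (k : fieldType) (Q : quiver) (p : qpath Q) :
  {malg k[qpath Q]} := << p >>.
Canonical path_basis_unlockable := Unlockable path_basis.unlock.

Section PathAlgebra.
Variables (k : fieldType) (Q : quiver).

Local Notation kQ := {malg k[qpath Q]}.
Local Notation path_mul := (@path_mul k Q).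
Local Notation path_one := (path_one k Q).
Local Notation path_mul_basis := (@path_mul_basis k Q).

Definition malg_lift (V : lmodType k) (F : qpath Q -> V) (x : kQ) : V :=
  \sum_(p <- msupp x) x@_p *: F p.

Lemma malg_liftEw V F (x : kQ) (D : {fset qpath Q}) :
  (msupp x `<=` D)%fset -> @malg_lift V F x = \sum_(p <- D) x@_p *: F p.
Proof.
move=> xD; rewrite /malg_lift [RHS](big_fsetID _ (mem (msupp x))) /=.
rewrite [X in _ + X]big1_fset ?addr0.
  apply: eq_fbigl => p; rewrite !inE /=.
  by apply/idP/andP => [px|[]//]; split=> //; apply: (fsubsetP xD).
by move=> p; rewrite !inE /= => /andP[_ /mcoeff_outdom ->] _; rewrite scale0r.
Qed.

Lemma malg_lift_linear V F : linear (@malg_lift V F).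
Proof.
move=> c x y; set D := (msupp (c *: x + y) `|` (msupp x `|` msupp y))%fset.
rewrite (@malg_liftEw _ _ (c *: x + y) D) ?fsubsetUl //.
rewrite (@malg_liftEw _ _ x D); last first.
  by apply: fsubset_trans (fsubsetUr _ _); apply: fsubsetUl.
rewrite (@malg_liftEw _ _ y D); last first.
  by apply: fsubset_trans (fsubsetUr _ _); apply: fsubsetUr.
rewrite scaler_sumr -big_split /=; apply: eq_bigr => p _.
by rewrite mcoeffD mcoeffZ scalerDl scalerA.
Qed.

HB.instance Definition _ (V : lmodType k) F := GRing.isLinear.Build k kQ V _
  (@malg_lift V F) (@malg_lift_linear V F).

Lemma malg_liftU V F p : @malg_lift V F << p >> = F p.
Proof.
rewrite /malg_lift msuppU oner_eq0 big_seq_fset1 mcoeffUU scale1r.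
by [].
Qed.

Lemma malg_basisE (x : kQ) : x = \sum_(p <- msupp x) x@_p *: << p >>.
Proof.
rewrite {1}[x]monalgE; apply: eq_bigr => p _.
apply/malgP => q.
rewrite mcoeffZ.
rewrite [LHS]mcoeffU.
rewrite [in RHS]mcoeffU.
by rewrite mulrnAr mulr1.
Qed.

Lemma malg_ind (P : kQ -> Prop) : P 0 ->
  (forall c p x, P x -> P (c *: << p >> + x)) -> forall x, P x.
Proof.
move=> P0 PD x; rewrite [x]malg_basisE.
by elim: (msupp x : seq _) => [|p s IH]; rewrite ?big_nil // big_cons; apply: PD.
Qed.

Lemma path_mulEl x y :
  path_mul x y = malg_lift (fun q => malg_lift (path_mul_basis q) y) x.
Proof.
rewrite unlock /malg_lift; apply: eq_bigr => q _.
by rewrite scaler_sumr; apply: eq_bigr => p _; rewrite scalerA.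
Qed.

Lemma path_mulEr x y :
  path_mul x y = malg_lift (fun p => malg_lift (path_mul_basis^~ p) x) y.
Proof.
rewrite unlock /malg_lift exchange_big /=; apply: eq_bigr => q _.
rewrite scaler_sumr; apply: eq_bigr => p _; rewrite scalerA mulrC.
by [].
Qed.

Lemma path_mulU q p : path_mul << q >> << p >> = path_mul_basis q p.
Proof. by rewrite path_mulEl !malg_liftU. Qed.

Lemma path_mulDl : left_distributive path_mul +%R.
Proof. by move=> x y z; rewrite !path_mulEl linearD. Qed.
Lemma path_mulDr : right_distributive path_mul +%R.
Proof. by move=> x y z; rewrite !path_mulEr linearD. Qed.
Lemma path_mul0r y : path_mul 0 y = 0.
Proof. by rewrite path_mulEl linear0. Qed.
Lemma path_mulr0 x : path_mul x 0 = 0.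
Proof. by rewrite path_mulEr linear0. Qed.
Lemma path_mulZl (c : k) x y : c *: path_mul x y = path_mul (c *: x) y.
Proof. by rewrite !path_mulEl linearZ. Qed.
Lemma path_mulZr (c : k) x y : c *: path_mul x y = path_mul x (c *: y).
Proof. by rewrite !path_mulEr linearZ. Qed.

Lemma path_mulA : associative path_mul.
Proof.
exact: (bilin_mulA malg_ind path_mulDl path_mulDr path_mul0r path_mulr0
  path_mulZl path_mulZr path_mulU).
Qed.
Lemma path_mul1r : left_id path_one path_mul.
Proof.
rewrite unlock; exact: (bilin_mul1r malg_ind path_mulDl path_mulDr path_mul0r path_mulr0
  path_mulZr path_mulU).
Qed.
Lemma path_mulr1 : right_id path_one path_mul.
Proof.
rewrite unlock; exact: (bilin_mulr1 malg_ind path_mulDl path_mulDr path_mul0r path_mulr0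
  path_mulZl path_mulU).
Qed.

Definition path_alg : pzAlgType k := PzAlg path_mulA path_mul1r path_mulr1
  path_mulDl path_mulDr path_mulZl path_mulZr.

Definition path_elt (p : qpath Q) : path_alg := path_basis k p.
Definition arrow_elt (a : arrow Q) : path_alg := path_elt (parrow a).

Lemma path_eltM q p : path_elt q * path_elt p =
  if pcomp q p is Some r then path_elt r else 0.
Proof.
rewrite -[LHS]/(path_mul _ _) /path_elt [@path_basis]unlock path_mulU.
by rewrite /path_mul_basis; case: pcomp.
Qed.

Local Open Scope classical_set_scope.

Definition arrow_ideal : ideal path_alg := gen_ideal (range arrow_elt).

Definition monomial_ideal (I : ideal path_alg) : Prop :=
  [/\ exists S : set (qpath Q),
        ideal_set I = ideal_set (gen_ideal [set path_elt p | p in S]),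
      (forall x, I x -> arrow_ideal x)
    & exists n, forall x, ideal_exp arrow_ideal n x -> I x].

Lemma ideal_exp_path n p : (n <= plen p)%N ->
  ideal_exp arrow_ideal n (path_elt p).
Proof.
elim: n p => [|n IH] p; first by move=> _; apply: mem_gen_ideal.
case: p => -[v s] /= cs; rewrite /plen /parrows /=.
case: s cs => // a s cs ns.
have /andP[/eqP av cs'] : composable v (a :: s) := cs.
apply: mem_gen_ideal; exists (path_elt (@QPath Q (arrow_tgt a, s) cs')).
exists (path_elt (parrow a)); split; first exact: IH.
  by apply: mem_gen_ideal; exists a.
rewrite path_eltM.
have [|r -> rE] := @pcomp_some Q (@QPath Q (arrow_tgt a, s) cs') (parrow a); first by [].
by congr path_elt; apply: val_inj; rewrite /= rE /psrc /parrows /= av.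
Qed.

End PathAlgebra.

Arguments path_elt k {Q} p.
Arguments arrow_elt k {Q} a.

(******************************************************************************)

(* Only finite configurations are considered: the finiteness of the classes of
   P in (f1) is then automatic, and the quiver is finite. An action of the
   infinite cyclic group on a finite set is given by the permutation through
   which the generator g acts. *)
Record fBC := FBC {
  angle :> finType;
  rot : {perm angle};
  Ppart : {set {set angle}};
  Lpart : {set {set angle}};
  deg : angle -> nat;
  Ppart_partition : finset.partition Ppart [set: angle];
  Lpart_partition : finset.partition Lpart [set: angle];
  deg_gt0 : forall e, (0 < deg e)%N;
  f1 : forall e, finset.pblock Lpart e \subset finset.pblock Ppart e;
  f2 : forall e1 e2, finset.pblock Lpart e1 = finset.pblock Lpart e2 ->
    finset.pblock Ppart (rot e1) = finset.pblock Ppart (rot e2);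
  f3 : forall e h, h \in porbit rot e -> deg h = deg e;
  f4 : forall e1 e2, finset.pblock Ppart e1 = finset.pblock Ppart e2 <->
    finset.pblock Ppart ((rot ^+ deg e1)%g e1) =
    finset.pblock Ppart ((rot ^+ deg e2)%g e2);
  f5 : forall e1 e2, finset.pblock Lpart e1 = finset.pblock Lpart e2 <->
    finset.pblock Lpart ((rot ^+ deg e1)%g e1) =
    finset.pblock Lpart ((rot ^+ deg e2)%g e2);
  (* words are listed from right to left, i.e. starting with L(e) *)
  f6 : forall e h,
    let cycle x :=
      [seq finset.pblock Lpart ((rot ^+ i)%g x) | i <- iota 0 (deg x)] in
    infix (cycle e) (cycle h) -> cycle e = cycle h }.

Section FBCAlgebra.
Variable E : fBC.

Definition Pcls (e : E) : {set E} := finset.pblock (@Ppart E) e.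
Definition Lcls (e : E) : {set E} := finset.pblock (@Lpart E) e.

Definition fbc_vertex : finType := {C : {set E} | C \in @Ppart E}.
Definition fbc_arrow : finType := {C : {set E} | C \in @Lpart E}.

Lemma Pcls_in e : Pcls e \in @Ppart E.
Proof.
by apply: pblock_mem; rewrite (cover_partition (Ppart_partition E)) inE.
Qed.
Lemma Lcls_in e : Lcls e \in @Lpart E.
Proof.
by apply: pblock_mem; rewrite (cover_partition (Lpart_partition E)) inE.
Qed.
Definition Pvertex (e : E) : fbc_vertex := exist _ (Pcls e) (Pcls_in e).
Definition Larrow (e : E) : fbc_arrow := exist _ (Lcls e) (Lcls_in e).

Lemma fbc_arrow_neq0 (C : fbc_arrow) : exists e : E, e \in val C.
Proof.
apply/set0Pn; have /and3P[_ _] := Lpart_partition E.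
by apply: contraNneq => <-; apply: (valP C).
Qed.
(* an arbitrary representative, see [fbc_srcE] and [fbc_tgtE] *)
Definition fbc_repr (C : fbc_arrow) : E := xchoose (fbc_arrow_neq0 C).
Definition fbc_src (C : fbc_arrow) : fbc_vertex := Pvertex (fbc_repr C).
Definition fbc_tgt (C : fbc_arrow) : fbc_vertex := Pvertex (rot E (fbc_repr C)).

Lemma Lcls_repr e : Lcls (fbc_repr (Larrow e)) = Lcls e.
Proof.
have /and3P[_ tI _] := Lpart_partition E.
by apply: (same_pblock tI); apply: (xchooseP (fbc_arrow_neq0 (Larrow e))).
Qed.

Lemma Lcls_Pcls e h : Lcls e = Lcls h -> Pcls e = Pcls h.
Proof.
move=> eh; have /and3P[_ tI _] := Ppart_partition E.
apply: (same_pblock tI); apply: (fintype.subsetP (f1 h)).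
rewrite -[finset.pblock _ _]/(Lcls h) -eh mem_pblock.
by rewrite (cover_partition (Lpart_partition E)) inE.
Qed.

Lemma fbc_srcE e : fbc_src (Larrow e) = Pvertex e.
Proof. by apply: val_inj; apply/Lcls_Pcls/Lcls_repr. Qed.
Lemma fbc_tgtE e : fbc_tgt (Larrow e) = Pvertex (rot E e).
Proof. by apply: val_inj; apply/f2/Lcls_repr. Qed.

Definition fbc_quiver : quiver :=
  @Quiver fbc_vertex fbc_arrow fbc_src fbc_tgt.

Section Relations.
Variable k : fieldType.
Local Notation kQ := (path_alg k fbc_quiver).

(* L(e_{n-1}) ... L(e_1) L(e_0) *)
Definition Lword (n : nat) (e : nat -> E) : kQ :=
  \prod_(i < n) arrow_elt k (Larrow (e (rev_ord i)) : arrow fbc_quiver).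

(* L(g^{n-1}(e)) ... L(g(e)) L(e) *)
Definition Lrotword (n : nat) (e : E) : kQ :=
  Lword n (fun i => (rot E ^+ i)%g e).

Variant fbc_relation : kQ -> Prop :=
| FBC_R1 (e h : E) (j : nat) of
    Pcls e = Pcls h & (j < deg e)%N & (j < deg h)%N &
    (forall i, (0 < i <= j)%N ->
      Lcls ((rot E ^+ (deg e - i))%g e) = Lcls ((rot E ^+ (deg h - i))%g h)) :
    fbc_relation (Lrotword (deg e - j) e - Lrotword (deg h - j) h)
| FBC_R2 (n : nat) (e : nat -> E) of
    (0 < n)%N &
    (forall i, (i.+1 < n)%N -> Pcls (rot E (e i)) = Pcls (e i.+1)) &
    \bigcap_(i < n) [set (rot E ^+ (n - i.+1))%g x | x in Lcls (e i)]
      = finset.set0 :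
    fbc_relation (Lword n e)
| FBC_R3 (e : E) (n : nat) of (deg e < n)%N :
    fbc_relation (Lrotword n e).

Definition fbc_ideal : ideal kQ := gen_ideal fbc_relation.
Definition fbc_alg : pzAlgType k := quot_alg fbc_ideal.

End Relations.

(* The pair (e, n), n <= d(e), encodes the standard sequence
   (g^{n-1}(e), ..., g(e), e), which is the trivial sequence ()_e for n = 0. *)
Definition standard (p : E * nat) : Prop := (p.2 <= deg p.1)%N.

Definition lwedge (p : E * nat) : E * nat :=
  ((rot E ^+ p.2)%g p.1, (deg p.1 - p.2)%N).
Definition rwedge (p : E * nat) : E * nat :=
  ((rot E ^- (deg p.1 - p.2))%g p.1, (deg p.1 - p.2)%N).

(* the formal path L(p): its source and its arrows, in the order of traversal *)
Definition Lpath (p : E * nat) : {set E} * seq {set E} :=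
  (Pcls p.1, [seq Lcls ((rot E ^+ i)%g p.1) | i <- iota 0 p.2]).

Local Open Scope classical_set_scope.

Definition std_closure (X : set (E * nat)) : set (E * nat) :=
  [set q | standard q /\ exists2 p, X p & Lpath q = Lpath p].

Definition typeS : Prop := forall p q : E * nat,
  standard p -> standard q -> Lpath p = Lpath q ->
  std_closure (rwedge @` std_closure [set lwedge p]) =
  std_closure (rwedge @` std_closure [set lwedge q]).

Definition symmetric_fBC : Prop := forall e : E, (rot E ^+ deg e)%g e = e.

End FBCAlgebra.

Record symmetric_fsBC := SymmetricFsBC {
  fsBC_fBC :> fBC;
  fsBC_typeS : typeS fsBC_fBC;
  fsBC_symmetric : symmetric_fBC fsBC_fBC }.

(******************************************************************************)

Section MaximalPaths.
Variables (k : fieldType) (Q : quiver) (I : ideal (path_alg k Q)).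
Local Notation pi := (quot_proj I).

Definition maximal_path (p : qpath Q) : Prop :=
  ~ I (path_elt k p) /\
  forall a : arrow Q, pi (arrow_elt k a) * pi (path_elt k p) = 0 /\
                      pi (path_elt k p) * pi (arrow_elt k a) = 0.

Hypothesis monI : monomial_ideal I.

Lemma monomial_bound :
  exists n, forall p : qpath Q, ~ I (path_elt k p) -> (plen p <= n)%N.
Proof.
have [_ _ [n nI]] := monI; exists n => p pI.
by case: (leqP n (plen p)) => [/(ideal_exp_path k)/nI //|/ltnW].
Qed.

End MaximalPaths.

Section MonomialConfiguration.
Variables (k : fieldType) (Q : quiver) (I : ideal (path_alg k Q)).
Variable monI : monomial_ideal I.

Definition max_path_of (_ : monomial_ideal I) : Type :=
  {p : qpath Q | `[< maximal_path I p >]}.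
Local Notation max_path := (max_path_of monI).

Definition max_path_val (p : max_path) : qpath Q := val p.
Coercion max_path_val : max_path_of >-> qpath.

Definition max_path_bound : nat := sval (cid (monomial_bound monI)).

Lemma max_path_bounded (p : max_path) : (size (parrows p) <= max_path_bound)%N.
Proof.
by have := svalP (cid (monomial_bound monI)); apply; case/asboolP: (valP p).
Qed.

Definition max_path_code (p : max_path) :
    vertex Q * max_path_bound.-bseq (arrow Q) :=
  (psrc p, Bseq (max_path_bounded p)).
Definition max_path_decode (x : vertex Q * max_path_bound.-bseq (arrow Q)) :
    option max_path :=
  obind insub (insub (x.1, val x.2)).

Lemma max_path_codeK : pcancel max_path_code max_path_decode.
Proof.
move=> p; rewrite /max_path_decode /= -surjective_pairing.
by rewrite -[qpath_val _]/(val (val p)) valK /= valK.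
Qed.

HB.instance Definition _ := Finite.copy (max_path_of monI) (pcan_type max_path_codeK).

(* Positions are counted from 0: the angle (e_{i+1}, p) is the pair of p and i. *)
Definition monomial_angle : Type := {p : max_path & 'I_(plen p).+1}.
HB.instance Definition _ := Finite.on monomial_angle.

Definition angle_path (x : monomial_angle) : max_path := tag x.
Definition angle_pos (x : monomial_angle) : nat := tagged x.

Definition angle_vertex (x : monomial_angle) : vertex Q :=
  nth (psrc (angle_path x)) (pvertices (angle_path x)) (angle_pos x).

(* the arrow starting at this position; at the last position there is none, and
   the angle is its own label *)
Definition angle_label (x : monomial_angle) : arrow Q + monomial_angle :=
  if onth (parrows (angle_path x)) (angle_pos x) is Some a then inl a
  else inr x.

Definition angle_next (x : monomial_angle) : monomial_angle :=
  Tagged (fun p : max_path => 'I_(plen p).+1) (ordS (tagged x)).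

Definition angle_deg (x : monomial_angle) : nat := (plen (angle_path x)).+1.

Lemma angle_next_inj : injective angle_next.
Proof.
apply: (can_inj (g := fun x : monomial_angle =>
  Tagged (fun p : max_path => 'I_(plen p).+1) (ord_pred (tagged x)))).
by case=> p i; rewrite /angle_next /= ordSK.
Qed.

Definition monomial_rot : {perm monomial_angle} := perm angle_next_inj.
Definition monomial_P : {set {set monomial_angle}} :=
  finset.preim_partition angle_vertex [set: monomial_angle].
Definition monomial_L : {set {set monomial_angle}} :=
  finset.preim_partition angle_label [set: monomial_angle].

Lemma angle_eq (x y : monomial_angle) :
  angle_path x = angle_path y -> angle_pos x = angle_pos y -> x = y.
Proof.
case: x y => [p i] [q j]; rewrite /angle_path /angle_pos /= => epq.
by case: q / epq j => j /= /val_inj ->.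
Qed.

Lemma angle_pos_lt x : (angle_pos x < angle_deg x)%N.
Proof. exact: ltn_ord. Qed.

Lemma monomial_rotX n (x : monomial_angle) :
  angle_path ((monomial_rot ^+ n)%g x) = angle_path x /\
  angle_pos ((monomial_rot ^+ n)%g x) = ((angle_pos x + n) %% angle_deg x)%N.
Proof.
rewrite permX; elim: n => [|n [IHt IHn]] /=.
  by rewrite addn0 modn_small // angle_pos_lt.
set y := iter _ _ _ in IHt IHn *; rewrite permE.
split; first by rewrite -IHt.
rewrite -[LHS]/((angle_pos y).+1 %% angle_deg y)%N /angle_deg IHt IHn.
by rewrite -addn1 modnDml addn1 addnS.
Qed.

Lemma monomial_rot_deg x : (monomial_rot ^+ angle_deg x)%g x = x.
Proof.
have [ep en] := monomial_rotX (angle_deg x) x; apply: angle_eq => //.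
by rewrite en modnDr modn_small // angle_pos_lt.
Qed.

Lemma angle_deg_path x y : angle_path x = angle_path y -> angle_deg x = angle_deg y.
Proof. by rewrite /angle_deg => ->. Qed.

Lemma angle_path_porbit x y :
  y \in porbit monomial_rot x -> angle_path y = angle_path x.
Proof. by case/porbitP => n ->; case: (monomial_rotX n x). Qed.

Lemma mem_pblock_preim (T : finType) (R : eqType) (f : T -> R) x y :
  (y \in finset.pblock (finset.preim_partition f [set: T]) x) = (f x == f y).
Proof.
rewrite pblock_equivalence_partition ?inE // => a b c _ _ _.
by split=> // /eqP ->.
Qed.

Lemma pblock_preim (T : finType) (R : eqType) (f : T -> R) x y :
  finset.pblock (finset.preim_partition f [set: T]) x =
  finset.pblock (finset.preim_partition f [set: T]) y <-> f x = f y.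
Proof.
split=> [e|e]; last by apply/setP => z; rewrite !mem_pblock_preim e.
by apply/eqP; rewrite -mem_pblock_preim e mem_pblock_preim.
Qed.

Definition angle_last x := angle_pos x == plen (angle_path x).

Lemma angle_label_last x : angle_last x -> angle_label x = inr x.
Proof. by rewrite /angle_label => /eqP ->; rewrite onth_default. Qed.

Lemma angle_labelP x :
  if angle_last x then angle_label x = inr x
  else exists2 a, angle_label x = inl a &
    arrow_src a = angle_vertex x /\ arrow_tgt a = angle_vertex (angle_next x).
Proof.
case: ifPn => [/angle_label_last //|nl].
have lt : (angle_pos x < plen (angle_path x))%N.
  by rewrite ltn_neqAle nl -ltnS; apply: angle_pos_lt.
rewrite /angle_label; case E: (onth _ _) => [a|]; last first.
  by have := onthTE (parrows (angle_path x)) (angle_pos x); rewrite E lt.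
exists a => //; rewrite /angle_vertex.
rewrite -[angle_pos (angle_next x)]/((angle_pos x).+1 %% _)%N.
rewrite modn_small // -[angle_path (angle_next x)]/(angle_path x).
move: (psrc (angle_path x)) (qpath_valP (angle_path x)) E => d.
rewrite /pvertices /psrc /parrows; case: (qpath_val _) => v s /=.
elim: (angle_pos x) v s => [|i IH] v [|b s] //= /andP[/eqP bv cs].
  by case=> <-.
exact: IH.
Qed.

Lemma angle_label_vertex x y : angle_label x = angle_label y ->
  angle_vertex x = angle_vertex y /\
  angle_vertex (angle_next x) = angle_vertex (angle_next y).
Proof.
have := angle_labelP x; have := angle_labelP y; case: ifP => _.
  by move=> ->; case: ifP => _ => [-> [->]|[a -> _]].
case=> a -> [<- <-]; case: ifP => _ => [->|[b -> [<- <-]] [->]] //.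
Qed.

Lemma angle_reach_last x :
  exists2 i, (i < angle_deg x)%N & angle_last ((monomial_rot ^+ i)%g x).
Proof.
exists (plen (angle_path x) - angle_pos x)%N.
  by rewrite ltnS leq_subr.
have [ep en] := monomial_rotX (plen (angle_path x) - angle_pos x)%N x.
by rewrite /angle_last ep en subnKC ?modn_small // -ltnS angle_pos_lt.
Qed.

Local Notation Lc := (finset.pblock monomial_L).

Lemma Lc_last x y : angle_last x -> Lc x = Lc y -> x = y.
Proof.
move=> lx /pblock_preim; rewrite (angle_label_last lx).
by have := angle_labelP y; case: ifP => [_ -> [->]|_ [a -> _]].
Qed.

Lemma monomial_partition (R : eqType) (f : monomial_angle -> R) :
  finset.partition (finset.preim_partition f [set: monomial_angle])
    [set: monomial_angle].
Proof. exact: preim_partitionP. Qed.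

Lemma monomial_f1 e :
  finset.pblock monomial_L e \subset finset.pblock monomial_P e.
Proof.
apply/fintype.subsetP => x; rewrite !mem_pblock_preim => /eqP.
by case/angle_label_vertex => ->.
Qed.

Lemma monomial_f2 e1 e2 : Lc e1 = Lc e2 ->
  finset.pblock monomial_P (monomial_rot e1) =
  finset.pblock monomial_P (monomial_rot e2).
Proof.
move/pblock_preim => h; apply/pblock_preim.
by rewrite !permE; case: (angle_label_vertex h).
Qed.

Lemma monomial_f3 e h : h \in porbit monomial_rot e -> angle_deg h = angle_deg e.
Proof. by move/angle_path_porbit/angle_deg_path. Qed.

Lemma monomial_f4 (B : {set {set monomial_angle}}) e1 e2 :
  finset.pblock B e1 = finset.pblock B e2 <->
  finset.pblock B ((monomial_rot ^+ angle_deg e1)%g e1) =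
  finset.pblock B ((monomial_rot ^+ angle_deg e2)%g e2).
Proof. by rewrite !monomial_rot_deg. Qed.

Lemma monomial_f6 e h :
  let cycle x := [seq Lc ((monomial_rot ^+ i)%g x) | i <- iota 0 (angle_deg x)] in
  infix (cycle e) (cycle h) -> cycle e = cycle h.
Proof.
move=> cycle inf.
have [i id il] := angle_reach_last e.
have mem : Lc ((monomial_rot ^+ i)%g e) \in cycle h.
  apply: (mem_infix inf); apply/mapP; exists i => //.
  by rewrite mem_iota.
case/mapP: mem => j _ /(Lc_last il) eij.
have edh : angle_deg e = angle_deg h.
  apply: angle_deg_path.
  by rewrite -(monomial_rotX i e).1 eij (monomial_rotX j h).1.
case/infixP: inf => s [s' E].
have : size (cycle h) = size (cycle e) by rewrite !size_map !size_iota.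
rewrite E !size_cat addnCA => /eqP.
rewrite -{2}[size (cycle e)]addn0 eqn_add2l addn_eq0 !size_eq0.
by case/andP => /eqP -> /eqP ->; rewrite cats0.
Qed.

Definition monomial_fBC : fBC :=
  @FBC monomial_angle monomial_rot monomial_P monomial_L angle_deg
    (monomial_partition _) (monomial_partition _) (fun _ => ltn0Sn _)
    monomial_f1 monomial_f2 monomial_f3
    (monomial_f4 _) (monomial_f4 _) monomial_f6.

Lemma monomial_symmetric : symmetric_fBC monomial_fBC.
Proof. exact: monomial_rot_deg. Qed.

Lemma Lpath_last (p q : monomial_fBC * nat) i :
  Lpath p = Lpath q -> (i < p.2)%N ->
  angle_last ((monomial_rot ^+ i)%g p.1) -> p = q.
Proof.
case: p q => [e n] [h m] [_ E] /= lt lst.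
have enm : n = m by move/(congr1 size): E; rewrite !size_map !size_iota.
rewrite -{}enm in E *; congr pair; apply: (perm_inj (s := (monomial_rot ^+ i)%g)).
apply: (Lc_last lst); have /= := congr1 (nth finset.set0 ^~ i) E.
by rewrite !(nth_map 0%N) ?size_iota // !nth_iota.
Qed.

Lemma lwedgeK (p : monomial_fBC * nat) : standard p -> rwedge (lwedge p) = p.
Proof.
case: p => e n; rewrite /standard /rwedge /lwedge /= => le.
have -> : angle_deg ((monomial_rot ^+ n)%g e) = angle_deg e.
  by apply: angle_deg_path; case: (monomial_rotX n e).
by rewrite subKn // -permM mulgV perm1.
Qed.

Lemma monomial_typeS : typeS monomial_fBC.
Proof.
move=> p q sp sq E; have [i id il] := angle_reach_last p.1.
have [ip|pi] := ltnP i p.2; first by rewrite (Lpath_last E ip il).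
have sq2 : p.2 = q.2.
  by case: E => _ /(congr1 size); rewrite !size_map !size_iota.
have closure1 (r : monomial_fBC * nat) j : standard r -> (r.2 <= j < deg r.1)%N ->
    angle_last ((monomial_rot ^+ j)%g r.1) ->
    std_closure [set lwedge r]%classic = [set lwedge r]%classic.
  move=> sr /andP[rj jd] jl; apply/seteqP; split=> x /=.
    case=> _ [_ -> /esym e]; apply/esym.
    apply: (Lpath_last (i := (j - r.2)%N) e).
      by rewrite /= ltn_sub2r // (leq_ltn_trans rj).
    by rewrite /= -permM -expgD subnKC.
  move=> ->; split; last by exists (lwedge r).
  rewrite /standard /lwedge /=.
  have -> : angle_deg ((monomial_rot ^+ r.2)%g r.1) = angle_deg r.1.
    by apply: angle_deg_path; case: (monomial_rotX r.2 r.1).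
  exact: leq_subr.
have closure2 (r : monomial_fBC * nat) j : standard r -> (r.2 <= j < deg r.1)%N ->
    angle_last ((monomial_rot ^+ j)%g r.1) ->
    std_closure (@rwedge monomial_fBC @` std_closure [set lwedge r])%classic =
    std_closure [set r]%classic.
  by move=> sr rj jl; rewrite (closure1 r j) // image_set1 lwedgeK.
have [j jd jl] := angle_reach_last q.1.
have [jq|qj] := ltnP j q.2; first by rewrite (Lpath_last (esym E) jq jl).
rewrite (closure2 p i) ?pi // (closure2 q j) ?qj //.
by apply/seteqP; split=> x [sx [_ -> ex]]; split=> //; [exists q|exists p];
  rewrite ?ex ?E.
Qed.

Definition monomial_fsBC : symmetric_fsBC :=
  SymmetricFsBC monomial_typeS monomial_symmetric.

End MonomialConfiguration.

(* Main.v *)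
From HB Require Import structures.
Require Import Defs.
From mathcomp Require Import all_boot fingroup perm ssralg.
From mathcomp Require Import boolp classical_sets generic_quotient.
From mathcomp Require Import finmap monalg.

(** The two algebras are compared on bases. Write [w] for a path of [Q] outside
    the monomial ideal [I], and [w^*] for the corresponding element of the dual
    basis of [D(A)]; the [w] and the [w^*] form a basis of [T(A)].

    An angle [e] is a position on a maximal path [p]. Turning from [e] through
    [n] angles spells a word in the arrows of the quiver of the configuration.
    Such an arrow is either an arrow of [Q] or the extra arrow of the last
    position of some maximal path [p]. Send the former to itself and the latter
    to [p^*]. If the [n] letters avoid the last position of [p], they spell a
    subpath [w] of [p] and the word is sent to [w]; if they pass it once, then
    the word runs through a final piece [u] of [p], the extra arrow and an
    initial piece [v] of [p], and it is sent to [x^*], where [x] is the piece of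
    [p] between [v] and [u], missing to complete the turn ([word_img_turn]). All
    remaining words are sent to zero: a product of arrows of [Q] that is nonzero
    in [A] lies on a maximal path, a product with one factor [p^*] is nonzero
    only when the other factors are the two ends of [p], and [D(A)] squares to
    zero ([word_img_standard_or0]).

    Hence the relations hold in [T(A)] ([path_img_relation]): the two sides of
    (R1) miss the same piece [x], or else share a last position and are equal;
    the words of (R2) and (R3) are not of the form above. Conversely these
    relations cut the path algebra down to the same basis: a word not of the
    form above is killed by (R2) or (R3) ([nonstandard_word_ideal]), a word that
    spells a path [w] of [Q] is determined by [w], and two words that miss the
    same piece [x] are identified by (R1) ([turn_elt_complement_eq]). So sending
    [w] to the word spelling it and [x^*] to a word missing [x] is an inverse. *)

Set Implicit Arguments.
Unset Strict Implicit.
Unset Printing Implicit Defensive.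

Import GRing.Theory.
Local Open Scope ring_scope.

(** * Words of arrows as elements of the path algebra *)

Section Words.
Variables (k : fieldType) (Q : quiver).
Implicit Types (v w : vertex Q) (s t u : seq (arrow Q)).
Local Notation kQ := (path_alg k Q).

Definition word_end v s : vertex Q := last v (map (@arrow_tgt Q) s).

(** Extending the path by zero on words that do not compose makes
    concatenation of words a total operation, and saves carrying proofs of
    composability: see [word_elt_cat], which has no side condition. *)
Definition word_elt v s : kQ :=
  if insub (v, s) is Some p then path_elt k p else 0.

Lemma word_end_cat v s t : word_end v (s ++ t) = word_end (word_end v s) t.
Proof. by rewrite /word_end map_cat last_cat. Qed.

Lemma word_end_rcons v s a : word_end v (rcons s a) = arrow_tgt a.
Proof. by rewrite /word_end map_rcons last_rcons. Qed.

Lemma word_elt_path (p : qpath Q) : word_elt (psrc p) (parrows p) = path_elt k p.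
Proof.
by rewrite /word_elt -surjective_pairing -[qpath_val p]/(val p) valK.
Qed.

Lemma word_eltE v s (cs : composable v s) :
  word_elt v s = path_elt k (@QPath Q (v, s) cs).
Proof. by rewrite -word_elt_path. Qed.

Lemma word_elt_ncomp v s : ~~ composable v s -> word_elt v s = 0.
Proof. by move=> ncs; rewrite /word_elt insubN. Qed.

Lemma word_eltM w t v s : word_elt w t * word_elt v s =
  if word_end v s == w then word_elt v (s ++ t) else 0.
Proof.
have [cs|ncs] := boolP (composable v s); last first.
  rewrite (word_elt_ncomp ncs) mulr0 word_elt_ncomp ?if_same //.
  by rewrite composable_cat (negbTE ncs).
have [ct|nct] := boolP (composable w t); last first.
  rewrite (word_elt_ncomp nct) mul0r; case: eqP => // e.
  by rewrite word_elt_ncomp // composable_cat -/(word_end v s) e (negbTE nct) andbF.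
rewrite (word_eltE cs) (word_eltE ct) path_eltM.
case: eqP => [e|/eqP ne]; last by rewrite pcomp_none.
have [|r -> rE] := @pcomp_some Q (@QPath Q (w, t) ct) (@QPath Q (v, s) cs); first by [].
by rewrite -word_elt_path /psrc /parrows rE.
Qed.

Lemma word_elt_cat v s t :
  word_elt v (s ++ t) = word_elt (word_end v s) t * word_elt v s.
Proof. by rewrite word_eltM eqxx. Qed.

Lemma arrow_eltE a : arrow_elt k a = word_elt (arrow_src a) [:: a].
Proof. by rewrite /arrow_elt -word_elt_path. Qed.

Lemma arrow_eltMl a v s : arrow_elt k a * word_elt v s = word_elt v (rcons s a).
Proof.
rewrite arrow_eltE word_eltM cats1; case: eqP => // ne.
rewrite word_elt_ncomp // -cats1 composable_cat /= andbT.
by rewrite -/(word_end v s) [_ == word_end _ _]eq_sym (introF eqP ne) andbF.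
Qed.

Lemma arrow_eltMr w s a : word_elt w s * arrow_elt k a =
  if w == arrow_tgt a then word_elt (arrow_src a) (a :: s) else 0.
Proof. by rewrite arrow_eltE word_eltM eq_sym. Qed.

Lemma path_alg1 : (1 : kQ) = \sum_v word_elt v [::].
Proof.
rewrite -[LHS]/(path_one k Q) [@path_one]unlock; apply: eq_bigr => v _.
by rewrite -[RHS]/(word_elt (psrc (pvertex v)) (parrows (pvertex v)))
  word_elt_path /path_elt [@path_basis]unlock.
Qed.

Lemma path_elt_coef (p q : qpath Q) : (path_elt k p)@_q = (p == q)%:R.
Proof. by rewrite /path_elt [@path_basis]unlock mcoeffU mulrb; case: eqP. Qed.

Lemma path_alg_ind (P : kQ -> Prop) : P 0 ->
  (forall c v s x, composable v s -> P x -> P (c *: word_elt v s + x)) ->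
  forall x, P x.
Proof.
move=> P0 PD; apply: malg_ind => // c p x Px.
have := PD c (psrc p) (parrows p) x (valP p) Px.
by rewrite word_elt_path /path_elt [@path_basis]unlock.
Qed.

Definition word_coef v s (x : kQ) : k :=
  if insub (v, s) is Some p then (x : {malg k[qpath Q]})@_p else 0.

Lemma word_coef0 v s : word_coef v s 0 = 0.
Proof. by rewrite /word_coef; case: insub => // p; rewrite mcoeff0. Qed.

Lemma word_coefD v s x y : word_coef v s (x + y) = word_coef v s x + word_coef v s y.
Proof. by rewrite /word_coef; case: insub => [p|]; rewrite ?mcoeffD ?addr0. Qed.

Lemma word_coefZ v s c x : word_coef v s (c *: x) = c * word_coef v s x.
Proof. by rewrite /word_coef; case: insub => [p|]; rewrite ?mcoeffZ ?mulr0. Qed.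

Lemma word_coefE v s w t : word_coef v s (word_elt w t) =
  (composable v s && ((w, t) == (v, s)))%:R.
Proof.
rewrite /word_coef; case: insubP => [p /= -> pE|/negbTE -> //].
rewrite /word_elt; case: insubP => [q _ qE|nc] /=.
  by rewrite path_elt_coef -pE -qE.
rewrite mcoeff0; case: eqP => // e; move: nc; rewrite e -pE.
by rewrite (valP p).
Qed.
End Words.

(** * Coordinates and dual bases of a monomial algebra *)

Section WordCoefficients.
Variables (k : fieldType) (Q : quiver).
Local Notation word_elt := (@word_elt k Q).
Local Notation word_coef := (@word_coef k Q).
Implicit Types (v w : vertex Q) (s t u y : seq (arrow Q)) (z : path_alg k Q).

Lemma word_coef_catl v u t z : composable v (u ++ t) ->
  word_coef v (u ++ t) (word_elt (word_end v u) t * z) = word_coef v u z.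
Proof.
move=> c; have /andP[cu _] : composable v u && composable (word_end v u) t.
  by rewrite -composable_cat.
elim/path_alg_ind: z => [|a w s z cs IH]; first by rewrite mulr0 !word_coef0.
rewrite mulrDr -pz_scalerAr !word_coefD !word_coefZ IH word_eltM; congr (_ * _ + _).
case: eqP => [e|ne]; rewrite ?word_coef0 !word_coefE ?c cu /=.
  by rewrite !xpair_eqE -[_ ++ _ == _](inj_eq (can_inj revK)) !rev_cat eqseq_cat //
    eqxx (inj_eq (can_inj revK)).
by rewrite xpair_eqE; case: eqP => // wv; case: eqP => // su; case: ne; rewrite wv su.
Qed.

Lemma word_coef_catr v s u z : composable v (s ++ u) ->
  word_coef v (s ++ u) (z * word_elt v s) = word_coef (word_end v s) u z.
Proof.
move=> c; have /andP[_ cu] : composable v s && composable (word_end v s) u.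
  by rewrite -composable_cat.
elim/path_alg_ind: z => [|a w t z ct IH]; first by rewrite mul0r !word_coef0.
rewrite mulrDl -pz_scalerAl !word_coefD !word_coefZ IH word_eltM; congr (_ * _ + _).
case: eqP => [e|ne]; rewrite ?word_coef0 !word_coefE ?c cu /=.
  by rewrite !xpair_eqE eqseq_cat // e !eqxx.
by rewrite xpair_eqE; case: eqP => // we; case: ne.
Qed.

(** This dichotomy is behind the vanishing of products with a dual basis element:
    they are zero unless the factor is an end of the path of that element. *)
Lemma word_coef_mull v y w t :
  (exists u, y = u ++ t /\ word_end v u = w) \/
  forall z, word_coef v y (word_elt w t * z) = 0.
Proof.
case: (pselect (exists u, y = u ++ t /\ word_end v u = w)); first by left.
move=> nu; right; elim/path_alg_ind => [|a w' s z cs IH].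
  by rewrite mulr0 word_coef0.
rewrite mulrDr -pz_scalerAr word_coefD word_coefZ IH addr0 word_eltM.
case: eqP => e; last by rewrite word_coef0 mulr0.
rewrite word_coefE xpair_eqE; case: (w' =P v) => [wv|_]; last first.
  by rewrite andbF mulr0.
case: (s ++ t =P y) => [sy|_]; last by rewrite !andbF mulr0.
by case: nu; exists s; rewrite -sy -wv.
Qed.

Lemma word_coef_mulr v y w s :
  (exists u, y = s ++ u /\ v = w) \/
  forall z, word_coef v y (z * word_elt w s) = 0.
Proof.
case: (pselect (exists u, y = s ++ u /\ v = w)); first by left.
move=> nu; right; elim/path_alg_ind => [|a w' t z ct IH].
  by rewrite mul0r word_coef0.
rewrite mulrDl -pz_scalerAl word_coefD word_coefZ IH addr0 word_eltM.
case: eqP => e; last by rewrite word_coef0 mulr0.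
rewrite word_coefE xpair_eqE; case: (w =P v) => [wv|_]; last first.
  by rewrite andbF mulr0.
case: (s ++ t =P y) => [sy|_]; last by rewrite !andbF mulr0.
by case: nu; exists t.
Qed.

(** Coordinates along trivial paths vanish on arrows and, since a trivial path
    only factors trivially, on the ideal that they generate. *)
Lemma arrow_ideal_coef v z : arrow_ideal k Q z -> word_coef v [::] z = 0.
Proof.
pose J (x : path_alg k Q) := forall w, word_coef w [::] x = 0.
suff JA : forall x, arrow_ideal k Q x -> J x by move/JA.
have JD (x y : path_alg k Q) : J x -> J y -> J (x + y).
  by move=> Jx Jy w; rewrite word_coefD Jx Jy addr0.
have JZ c (x : path_alg k Q) : J x -> J (c *: x).
  by move=> Jx w; rewrite word_coefZ Jx mulr0.
have J0 : J 0 by move=> w; rewrite word_coef0.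
move=> y; apply; split; last first.
  by move=> _ [a _ <-] w; rewrite arrow_eltE word_coefE xpair_eqE !andbF.
split=> // a x b Jx.
have {}Jx : J (a * x).
  elim/path_alg_ind: a => [|c w t a _ IH]; first by rewrite mul0r.
  rewrite mulrDl -pz_scalerAl; apply: JD IH; apply: JZ => u.
  have [[s [+ <-]]|z0] := word_coef_mull u [::] w t; last by rewrite z0.
  by case: s t => // -[] // _; rewrite (@word_coef_catl u [::] [::]).
elim/path_alg_ind: b => [|c w t b _ IH]; first by rewrite mulr0.
rewrite mulrDr -pz_scalerAr; apply: JD IH; apply: JZ => u.
have [[s [+ ->]]|z0] := word_coef_mulr u [::] w t; last by rewrite z0.
by case: t s => // -[] // _; rewrite (@word_coef_catr w [::] [::]).
Qed.

End WordCoefficients.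

Section MonomialDual.
Variables (k : fieldType) (Q : quiver) (I : ideal (path_alg k Q)).
Hypothesis monI : monomial_ideal I.
Local Notation pi := (quot_proj I).
Local Notation A := (quot_alg I).
Local Notation word_elt := (@word_elt k Q).
Local Notation word_coef := (@word_coef k Q).
Implicit Types (v w : vertex Q) (s t u y : seq (arrow Q)).

Lemma quot_projD (x y : path_alg k Q) : pi (x + y) = pi x + pi y.
Proof. exact: rmorphD. Qed.
Lemma quot_projM (x y : path_alg k Q) : pi (x * y) = pi x * pi y.
Proof. exact: rmorphM. Qed.
Lemma quot_proj_eq0 (x : path_alg k Q) : pi x = 0 <-> I x.
Proof. by rewrite -[0](rmorph0 pi) quot_projP subr0. Qed.

Definition nonzero_word v s : Prop := ~ I (word_elt v s).

Lemma nonzero_word_comp v s : nonzero_word v s -> composable v s.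
Proof. by apply: contra_notT => /word_elt_ncomp ->; apply: ideal0. Qed.

Lemma nonzero_word_catl v s t : nonzero_word v (s ++ t) -> nonzero_word v s.
Proof. by apply: contra_not; rewrite word_elt_cat; apply: idealMl. Qed.

Lemma nonzero_word_catr v s t :
  nonzero_word v (s ++ t) -> nonzero_word (word_end v s) t.
Proof. by apply: contra_not; rewrite word_elt_cat; apply: idealMr. Qed.

Lemma nonzero_word_nil v : nonzero_word v [::].
Proof.
case: monI => _ Ia _ /Ia /(arrow_ideal_coef v).
by rewrite word_coefE eqxx /=; apply/eqP/oner_neq0.
Qed.

Definition monomial_support (x : path_alg k Q) : Prop :=
  forall v s, word_coef v s x <> 0 -> I (word_elt v s).

(** Membership is inherited by all words extending a word of [I]; this is what
    makes the elements supported on words of [I] a two-sided ideal. It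
    contains the generating paths of [I], whence [monomial_ideal_coef]. *)
Lemma monomial_support_ideal : two_sided_ideal (monomial_support : set _).
Proof.
have D (x y : path_alg k Q) : monomial_support x ->
    monomial_support y -> monomial_support (x + y).
  move=> Px Py v s; rewrite word_coefD.
  case: (pselect (word_coef v s x = 0)) => [->|/Px //].
  by rewrite add0r => /Py.
have Z c (x : path_alg k Q) : monomial_support x -> monomial_support (c *: x).
  move=> Px v s; rewrite word_coefZ => h; apply: Px => e.
  by apply: h; rewrite e mulr0.
have Z0 : monomial_support 0 by move=> v s; rewrite word_coef0.
split=> // a x b Px.
have {}Px : monomial_support (a * x).
  elim/path_alg_ind: a => [|c w t a _ IH]; first by rewrite mul0r.
  rewrite mulrDl -pz_scalerAl; apply: D IH; apply: Z => v s.
  have [[u [-> <-]]|z0] := word_coef_mull k v s w t; last by rewrite z0.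
  have [c1|/word_elt_ncomp -> _] := boolP (composable v (u ++ t)); last exact: ideal0.
  by rewrite word_coef_catl // word_elt_cat => /Px; apply: idealMl.
elim/path_alg_ind: b => [|c w t b _ IH]; first by rewrite mulr0.
rewrite mulrDr -pz_scalerAr; apply: D IH; apply: Z => v s.
have [[u [-> ->]]|z0] := word_coef_mulr k v s w t; last by rewrite z0.
have [c1|/word_elt_ncomp -> _] := boolP (composable w (t ++ u)); last exact: ideal0.
by rewrite word_coef_catr // word_elt_cat => /Px; apply: idealMr.
Qed.

Lemma monomial_ideal_coef v s x : I x -> nonzero_word v s -> word_coef v s x = 0.
Proof.
move=> Ix nz; apply: contra_notP nz => nz.
suff : monomial_support x by apply.
case: monI => -[S IS] _ _; move: (Ix); rewrite IS; apply.
split; first exact: monomial_support_ideal.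
move=> _ [p Sp <-] w t; rewrite -word_elt_path word_coefE.
case: eqP => [[<- <-] _|]; last by rewrite andbF.
rewrite IS word_elt_path; apply: mem_gen_ideal; by exists p.
Qed.

(** For words in [I] the coordinate does not descend to the quotient, and zero
    is taken instead. *)
Definition word_dual_fun v s (a : A) : k^o :=
  if `[< nonzero_word v s >] then word_coef v s (repr a) else 0.

Lemma word_dual_funE v s x : nonzero_word v s ->
  word_dual_fun v s (pi x) = word_coef v s x.
Proof.
move=> nz; rewrite /word_dual_fun asboolT //; apply/eqP; rewrite -subr_eq0.
have -> : word_coef v s (repr (pi x)) =
    word_coef v s (repr (pi x) - x) + word_coef v s x by rewrite -word_coefD subrK.
by rewrite addrK; apply/eqP/monomial_ideal_coef => //; apply: repr_quot_pi.
Qed.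

Lemma word_dual_subproof v s : word_dual_fun v s \in @linear_pred k A.
Proof.
apply/asboolP => c a b.
have [nz|zz] := pselect (nonzero_word v s); last first.
  by rewrite /word_dual_fun asboolF // scaler0 addr0.
have [x ->] := quot_proj_surj a; have [y ->] := quot_proj_surj b.
by rewrite -quot_projZ -quot_projD !word_dual_funE // word_coefD word_coefZ.
Qed.

Definition word_dual v s : dual A := Dual (word_dual_subproof v s).

Lemma word_dualE v s x : nonzero_word v s ->
  word_dual v s (pi x) = word_coef v s x.
Proof. exact: word_dual_funE. Qed.

(** Paths cancel: a product that begins with a given final piece of a path is
    that path only if the other factor is the remaining initial piece. So
    multiplying a dual basis element by a final piece of its path leaves the
    dual of the initial piece, and symmetrically below. *)
Lemma word_dual_catl v u t (z : A) : nonzero_word v (u ++ t) ->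
  word_dual v (u ++ t) (pi (word_elt (word_end v u) t) * z) = word_dual v u z.
Proof.
move=> nz; have [x ->] := quot_proj_surj z.
rewrite -quot_projM !word_dualE //; last exact: nonzero_word_catl nz.
by rewrite word_coef_catl ?(nonzero_word_comp nz).
Qed.

Lemma word_dual_catr v s u (z : A) : nonzero_word v (s ++ u) ->
  word_dual v (s ++ u) (z * pi (word_elt v s)) = word_dual (word_end v s) u z.
Proof.
move=> nz; have [x ->] := quot_proj_surj z.
rewrite -quot_projM !word_dualE //; last exact: nonzero_word_catr nz.
by rewrite word_coef_catr ?(nonzero_word_comp nz).
Qed.

Lemma word_dual_mull v y w t :
  (exists u, y = u ++ t /\ word_end v u = w) \/
  forall z : A, word_dual v y (pi (word_elt w t) * z) = 0.
Proof.
have [|h] := word_coef_mull k v y w t; first by left.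
right=> z; have [x ->] := quot_proj_surj z.
have [nz|zz] := pselect (nonzero_word v y); first by rewrite -quot_projM word_dualE.
by rewrite /word_dual /= /word_dual_fun asboolF.
Qed.

Lemma word_dual_mulr v y w s :
  (exists u, y = s ++ u /\ v = w) \/
  forall z : A, word_dual v y (z * pi (word_elt w s)) = 0.
Proof.
have [|h] := word_coef_mulr k v y w s; first by left.
right=> z; have [x ->] := quot_proj_surj z.
have [nz|zz] := pselect (nonzero_word v y); first by rewrite -quot_projM word_dualE.
by rewrite /word_dual /= /word_dual_fun asboolF.
Qed.

(** A power of the arrow ideal lies in [I], so nonzero paths have bounded
    length and can be listed. *)
Lemma nonzero_paths : exists r : seq (qpath Q),
  uniq r /\ forall p, (p \in r) = `[< nonzero_word (psrc p) (parrows p) >].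
Proof.
have [n nP] := monomial_bound monI.
pose all_words := enum {: vertex Q * n.-bseq (arrow Q)}.
pose all_paths : seq (qpath Q) :=
  pmap insub [seq (x.1, val x.2) | x : vertex Q * n.-bseq (arrow Q) <- all_words].
exists [seq p <- all_paths | `[< nonzero_word (psrc p) (parrows p) >]]; split.
  apply/filter_uniq/pmap_sub_uniq; rewrite map_inj_uniq ?enum_uniq //.
  by move=> [v s] [w t] /= [-> /val_inj ->].
move=> p; rewrite mem_filter; case: asboolP => //= nz.
have le : (size (parrows p) <= n)%N.
  by apply: nP; rewrite -word_elt_path.
rewrite mem_pmap_sub; apply/mapP; exists (psrc p, Bseq le); first by rewrite mem_enum.
by rewrite /= -surjective_pairing.
Qed.

Section Bases.
Variable r : seq (qpath Q).
Hypotheses (r_uniq : uniq r)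
  (mem_r : forall p, (p \in r) = `[< nonzero_word (psrc p) (parrows p) >]).

(** The nonzero paths span [A], and their duals are the coordinates. *)
Lemma quot_basisE (a : A) :
  a = \sum_(p <- r) word_dual (psrc p) (parrows p) a *: pi (path_elt k p).
Proof.
have [x ->] := quot_proj_surj a; elim/path_alg_ind: x => [|c v s x cs IH].
  rewrite rmorph0 big1 // => p _; rewrite -[X in word_dual _ _ X](scale0r 0).
  by rewrite dualZ !scale0r.
have wE : pi (word_elt v s) = \sum_(p <- r)
    word_dual (psrc p) (parrows p) (pi (word_elt v s)) *: pi (path_elt k p).
  have [Iv|nz] := pselect (I (word_elt v s)); last first.
    have pr : QPath (qpath_val := (v, s)) cs \in r by rewrite mem_r; apply/asboolP.
    rewrite (bigD1_seq _ pr r_uniq) /= big1_seq ?addr0.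
      by rewrite -word_eltE word_dual_funE // word_coefE cs eqxx scale1r.
    move=> p /andP[np]; rewrite mem_r => /asboolP pnz.
    rewrite word_dual_funE // word_coefE; case: eqP => [[e1 e2]|_].
      by case/eqP: np; apply: val_inj; rewrite /= e1 e2 -surjective_pairing.
    by rewrite andbF scale0r.
  have -> : pi (word_elt v s) = 0.
    exact/quot_proj_eq0.
  rewrite big1 // => p _; rewrite -[X in word_dual _ _ X](scale0r 0).
  by rewrite dualZ !scale0r.
transitivity (c *: pi (word_elt v s) + pi x); first by rewrite quot_projD quot_projZ.
rewrite wE IH scaler_sumr -big_split; apply: eq_bigr => p _.
by rewrite quot_projD quot_projZ dualD dualZ scalerDl scalerA.
Qed.

Lemma dual_basisE (f : dual A) :
  f = \sum_(p <- r) f (pi (path_elt k p)) *: word_dual (psrc p) (parrows p).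
Proof.
apply: dualP => z; rewrite {1}[z]quot_basisE.
have fsum (l : seq (qpath Q)) G : f (\sum_(p <- l) G p) = \sum_(p <- l) f (G p).
  apply: (big_morph f); first exact: dualD.
  by rewrite -(scale0r (0 : A)) dualZ scale0r.
have sumf (l : seq (qpath Q)) (G : qpath Q -> dual A) :
    (\sum_(p <- l) G p) z = \sum_(p <- l) G p z.
  by apply: (big_morph (fun g : dual A => g z)).
rewrite fsum sumf; apply: eq_bigr => p _.
by rewrite dualZ dual_scaleE [LHS]mulrC.
Qed.

End Bases.
End MonomialDual.

(** * The universal property of the path algebra *)

Section PathAlgebraLift.
Variables (k : fieldType) (Q : quiver) (T : pzAlgType k).
Variables (eps : vertex Q -> T) (tau : arrow Q -> T).
Local Notation kQ := (path_alg k Q).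

(** The product starts from the idempotent of the source rather than from [1],
    so that trivial paths have the right value and values of words that do not
    compose have product zero. *)
Definition word_val (v : vertex Q) (s : seq (arrow Q)) : T :=
  foldl (fun x a => tau a * x) (eps v) s.

Definition path_lift (x : kQ) : T :=
  malg_lift (fun p => word_val (psrc p) (parrows p)) x.

Lemma word_val_rcons v s a : word_val v (rcons s a) = tau a * word_val v s.
Proof. by rewrite /word_val foldl_rcons. Qed.

Lemma path_liftD x y : path_lift (x + y) = path_lift x + path_lift y.
Proof. exact: linearD. Qed.

Lemma path_liftZ c x : path_lift (c *: x) = c *: path_lift x.
Proof. exact: linearZ. Qed.

Lemma path_liftB x y : path_lift (x - y) = path_lift x - path_lift y.
Proof. exact: linearB. Qed.

Lemma path_lift0 : path_lift 0 = 0.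
Proof. exact: linear0. Qed.

Lemma path_lift_path p : path_lift (path_elt k p) = word_val (psrc p) (parrows p).
Proof. by rewrite /path_elt [@path_basis]unlock /path_lift malg_liftU. Qed.

Lemma path_lift_word v s : composable v s ->
  path_lift (word_elt k v s) = word_val v s.
Proof. by move=> cs; rewrite word_eltE path_lift_path. Qed.

Hypothesis epsM : forall w v, eps w * eps v = if w == v then eps v else 0.
Hypothesis eps_tau : forall w a,
  eps w * tau a = if w == arrow_tgt a then tau a else 0.
Hypothesis eps_sum : \sum_v eps v = 1.

Lemma eps_word_val w v s :
  eps w * word_val v s = if w == word_end v s then word_val v s else 0.
Proof.
case/lastP: s => [|s a]; first exact: epsM.
rewrite word_val_rcons word_end_rcons mulrA eps_tau.
by case: eqP => // _; rewrite mul0r.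
Qed.

Lemma word_valM w t v s : word_val w t * word_val v s =
  if word_end v s == w then word_val v (s ++ t) else 0.
Proof.
elim/last_ind: t => [|t a IH].
  by rewrite cats0 [LHS]eps_word_val eq_sym.
rewrite -rcons_cat !word_val_rcons -mulrA IH.
by case: eqP => // _; rewrite mulr0.
Qed.

Lemma path_liftM x y : path_lift (x * y) = path_lift x * path_lift y.
Proof.
elim/path_alg_ind: x y => [|c w t x ct IHx] y; first by rewrite mul0r path_lift0 mul0r.
rewrite mulrDl !path_liftD mulrDl IHx; congr (_ + _).
rewrite -(pz_scalerAl c (word_elt k w t) y).
rewrite [LHS]path_liftZ [in RHS]path_liftZ.
rewrite -(pz_scalerAl c (path_lift _)); congr (_ *: _).
elim/path_alg_ind: y {IHx} => [|d v s y cs IHy]; first by rewrite mulr0 path_lift0 mulr0.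
rewrite mulrDr !path_liftD mulrDr IHy; congr (_ + _).
rewrite -(pz_scalerAr d (word_elt k w t)).
rewrite [LHS]path_liftZ [X in _ = _ * X]path_liftZ.
rewrite -(pz_scalerAr d (path_lift _)); congr (_ *: _).
rewrite word_eltM !path_lift_word // word_valM.
case: eqP => [e|_]; last exact: path_lift0.
by rewrite path_lift_word // composable_cat cs -/(word_end v s) e.
Qed.

Lemma path_lift1 : path_lift 1 = 1.
Proof.
rewrite path_alg1 -eps_sum (big_morph path_lift path_liftD path_lift0).
by apply: eq_bigr => v _; rewrite path_lift_word.
Qed.

End PathAlgebraLift.

(** * Angles, their labels and the words they spell *)

Section Angles.
Local Open Scope nat_scope.
Variables (k : fieldType) (Q : quiver) (I : ideal (path_alg k Q)).
Variable monI : monomial_ideal I.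
Local Notation E := (monomial_fBC monI).
Local Notation QE := (fbc_quiver E).
Local Notation angle_path := (@angle_path k Q I monI).
Local Notation "e +> n" := ((monomial_rot monI ^+ n)%g e)
  (at level 50, left associativity).
Implicit Types (e h : monomial_angle monI) (n m i : nat).

Lemma pvertices_nth (x v : vertex Q) (s : seq (arrow Q)) i : i <= size s ->
  nth x (v :: map (@arrow_tgt Q) s) i = word_end v (take i s).
Proof. by elim: s v i => [|a s IH] v [|i] //= /IH ->. Qed.

(** Truncated at the end of the maximal path: it has [n] letters only under
    [before_end e n]. *)
Definition angle_word e n : seq (arrow Q) :=
  take n (drop (angle_pos e) (parrows (angle_path e))).

(** The first [n] letters spelled from [e] are arrows of [Q], the last position
    of the maximal path not being among them. *)
Definition before_end e n := angle_pos e + n <= plen (angle_path e).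

Lemma angle_pos_le e : angle_pos e <= plen (angle_path e).
Proof. exact: angle_pos_lt. Qed.

Lemma angle_vertexE e : angle_vertex e =
  word_end (psrc (angle_path e)) (take (angle_pos e) (parrows (angle_path e))).
Proof. exact/pvertices_nth/angle_pos_le. Qed.

Lemma turn_path e n : angle_path (e +> n) = angle_path e.
Proof. by case: (monomial_rotX n e). Qed.

Lemma turn_deg e n : angle_deg (e +> n) = angle_deg e.
Proof. by rewrite /angle_deg turn_path. Qed.

Lemma turn_pos e n : angle_pos (e +> n) = (angle_pos e + n) %% angle_deg e.
Proof. by case: (monomial_rotX n e). Qed.

Lemma turn_pos_small e n : before_end e n -> angle_pos (e +> n) = angle_pos e + n.
Proof. by move=> le; rewrite turn_pos modn_small. Qed.

(** Within one full turn the last position is passed at most once, so the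
    position wraps around exactly once. *)
Lemma turn_pos_wrap e n : n <= angle_deg e -> ~~ before_end e n ->
  angle_pos (e +> n) + angle_deg e = angle_pos e + n.
Proof.
rewrite /before_end -ltnNge => le lt; rewrite turn_pos.
have lt2 : angle_deg e <= angle_pos e + n by [].
rewrite -{1}(subnK lt2) modnDr modn_small ?subnK //.
by rewrite ltn_subLR // -addSn leq_add // angle_pos_lt.
Qed.

Lemma turnD e n m : e +> n +> m = e +> (n + m).
Proof. by rewrite expgD permM. Qed.

Lemma turnS e n : e +> n.+1 = angle_next (e +> n).
Proof. by rewrite expgSr permM permE. Qed.

(** When the letters spelled from [e] pass the last position, those that
    complete the turn do not. This missing piece indexes the dual basis element
    to which the word is sent. *)
Lemma wrap_before_end e n : n <= angle_deg e -> ~~ before_end e n ->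
  before_end (e +> n) (angle_deg e - n).
Proof.
move=> le nb; have w := turn_pos_wrap le nb.
by rewrite /before_end turn_path addnBA // w addnK angle_pos_le.
Qed.

Lemma size_angle_word e n : before_end e n -> size (angle_word e n) = n.
Proof.
move=> le; rewrite /angle_word size_takel // size_drop.
by rewrite leq_subRL ?angle_pos_le.
Qed.

Lemma angle_labelE e a : angle_label e = inl a <->
  onth (parrows (angle_path e)) (angle_pos e) = Some a.
Proof.
rewrite /angle_label; case: (onth _ _) => [b|]; last by [].
by split=> [[->]|[->]].
Qed.

Lemma angle_label_inl e : angle_pos e < plen (angle_path e) ->
  exists a, angle_label e = inl a.
Proof.
rewrite /angle_label -onthTE; case: (onth _ _) => // a _.
by exists a.
Qed.

Lemma angle_label_inr e x : angle_label e = inr x ->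
  x = e /\ angle_pos e = plen (angle_path e).
Proof.
have := angle_labelP e; rewrite /angle_last; case: eqP => [-> -> [->] //|_].
by case=> a ->.
Qed.

Lemma angle_label_end e : angle_pos e = plen (angle_path e) -> angle_label e = inr e.
Proof. by move=> le; apply: angle_label_last; rewrite /angle_last le. Qed.

Lemma angle_label_src e a : angle_label e = inl a -> arrow_src a = angle_vertex e.
Proof.
have := angle_labelP e; case: ifP => _; first by move=> ->.
by case=> b -> [<- _] [->].
Qed.

Lemma angle_label_tgt e a : angle_label e = inl a ->
  arrow_tgt a = angle_vertex (angle_next e).
Proof.
have := angle_labelP e; case: ifP => _; first by move=> ->.
by case=> b -> [_ <-] [->].
Qed.

Lemma angle_word_rcons e n a : before_end e n ->
  angle_label (e +> n) = inl a -> angle_word e n.+1 = rcons (angle_word e n) a.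
Proof.
move=> le /angle_labelE; rewrite turn_path turn_pos_small // => oa.
have lt : angle_pos e + n < size (parrows (angle_path e)).
  by rewrite -onthTE oa.
rewrite /angle_word (take_nth a) ?size_drop ?ltn_subRL // nth_drop.
by rewrite (onth_nth a _ _ _ oa).
Qed.

Lemma angle_word_cons e m a : angle_label e = inl a ->
  angle_word e m.+1 = a :: angle_word (e +> 1) m.
Proof.
move=> /angle_labelE oa.
have lt : angle_pos e < size (parrows (angle_path e)) by rewrite -onthTE oa.
rewrite /angle_word turn_path turn_pos_small ?/before_end ?addn1 //.
rewrite (drop_nth a lt) /=; congr (_ :: _).
by rewrite (onth_nth a _ _ _ oa).
Qed.

Lemma angle_word_labels e n : before_end e n ->
  [seq angle_label (e +> i) | i <- iota 0 n] = [seq inl a | a <- angle_word e n].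
Proof.
elim: n => [|n IH] le; first by rewrite /angle_word take0.
have le' : before_end e n by apply: leq_trans le; rewrite leq_add2l.
have [a ea] : exists a, angle_label (e +> n) = inl a.
  by apply: angle_label_inl; rewrite turn_path turn_pos_small // -addnS.
rewrite -addn1 iotaD add0n map_cat IH //= addn1 (angle_word_rcons le' ea) map_rcons.
by rewrite ea cats1.
Qed.

Lemma psrc_arrows_nonzero (p : max_path_of monI) :
  nonzero_word I (psrc p) (parrows p).
Proof. by rewrite /nonzero_word word_elt_path; case/asboolP: (valP p). Qed.

Lemma angle_word_nonzero e n : nonzero_word I (angle_vertex e) (angle_word e n).
Proof.
have := @psrc_arrows_nonzero (angle_path e).
rewrite -{1}(cat_take_drop (angle_pos e) (parrows _)) => /nonzero_word_catr.
rewrite -angle_vertexE -{1}(cat_take_drop n (drop _ _)).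
exact: nonzero_word_catl.
Qed.

Definition angle_at (p : max_path_of monI) i (le : i <= plen p) : monomial_angle monI :=
  Tagged (fun p : max_path_of monI => 'I_(plen p).+1) (Ordinal (le : i < (plen p).+1)).

Lemma max_path_split (p : max_path_of monI) u t s : parrows p = u ++ s ++ t ->
  exists e, [/\ angle_path e = p, angle_pos e = size u,
    angle_vertex e = word_end (psrc p) u, before_end e (size s)
    & angle_word e (size s) = s].
Proof.
move=> pE; have le : size u <= plen p by rewrite /plen pE size_cat leq_addr.
exists (angle_at le); split=> //.
- by rewrite angle_vertexE /= [parrows _]pE take_size_cat.
- by rewrite /before_end /= /plen [parrows _]pE !size_cat leq_add2l leq_addr.
- by rewrite /angle_word /= [parrows _]pE drop_size_cat // take_size_cat.
Qed.

(** A nonzero path that is not maximal can be prolonged on one side to a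
    nonzero path; lengths being bounded, this stops at a maximal path. *)
Lemma nonzero_word_extend v s : nonzero_word I v s ->
  exists (p : max_path_of monI) u t,
    parrows p = u ++ s ++ t /\ word_end (psrc p) u = v.
Proof.
have [N NP] := monomial_bound monI.
have [n] := ubnP (N.+1 - size s); elim: n v s => // n IH v s /[!ltnS] le nz.
have cs := nonzero_word_comp nz.
pose q : qpath Q := QPath (qpath_val := (v, s)) cs.
have qE : path_elt k q = word_elt k v s by rewrite word_eltE.
have szs : size s <= N by apply: (NP q); rewrite qE.
have [mq|/existsNP[a na]] := pselect (forall a : arrow Q,
    I (word_elt k v (rcons s a)) /\
    (arrow_tgt a = v -> I (word_elt k (arrow_src a) (a :: s)))).
  have mxq : `[< maximal_path I q >].
    apply/asboolP; split; first by rewrite qE.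
    move=> a; have [Il Ir] := mq a; rewrite qE.
    rewrite -!quot_projM !quot_proj_eq0 arrow_eltMl arrow_eltMr; split=> //.
    by case: eqP => [/esym/Ir|] // _; apply: ideal0.
  exists (exist _ q mxq : max_path_of monI), [::], [::].
  by rewrite cats0.
have ext w u t : nonzero_word I w (u ++ s ++ t) -> word_end w u = v ->
    0 < size u + size t -> exists (p : max_path_of monI) u t,
    parrows p = u ++ s ++ t /\ word_end (psrc p) u = v.
  move=> nzw we gt0; have [|p [u' [t' [pE pv]]]] := IH w _ _ nzw.
    apply: leq_trans le; rewrite !size_cat addnCA.
    by rewrite ltn_sub2l ?ltnS // -[ltnLHS]addn0 ltn_add2l.
  exists p, (u' ++ u), (t ++ t'); split; first by rewrite pE -!catA.
  by rewrite word_end_cat pv.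
case/not_andP: na => [nzr|].
  by apply: (ext v [::] [:: a]) => //; rewrite cats1.
case/not_implyP => tv nzl; apply: (ext (arrow_src a) [:: a] [::]) => //.
by rewrite cats0.
Qed.

Lemma nonzero_word_angle v s : nonzero_word I v s ->
  exists e, [/\ angle_vertex e = v, before_end e (size s) & angle_word e (size s) = s].
Proof.
case/nonzero_word_extend => p [u [t [pE pv]]].
by have [e [_ _ ev eb ew]] := max_path_split pE; exists e; rewrite ev pv.
Qed.

Definition arrow_label (C : arrow QE) : arrow Q + monomial_angle monI :=
  angle_label (fbc_repr C).

Lemma arrow_labelE e : arrow_label (Larrow (e : E)) = angle_label e.
Proof.
by apply/(pblock_preim (@angle_label k Q I monI)); apply: (Lcls_repr (e : E)).
Qed.

Lemma Larrow_repr (C : fbc_arrow E) : Larrow (fbc_repr C) = C.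
Proof.
apply: val_inj; have /and3P[_ tI _] := Lpart_partition E.
rewrite /= /Lcls; apply: def_pblock => //; first exact: valP C.
exact: (xchooseP (fbc_arrow_neq0 C)).
Qed.

(** Arrows of the quiver of the configuration are faithfully represented by the
    labels shared by the angles of their class: an arrow of [Q], or a last
    angle. *)
Lemma arrow_label_inj : injective arrow_label.
Proof.
move=> C D eCD; rewrite -(Larrow_repr C) -(Larrow_repr D).
by apply: val_inj; apply/pblock_preim.
Qed.

Lemma Pvertex_surj (C : fbc_vertex E) : exists e : E, C = Pvertex e.
Proof.
have /and3P[_ tI n0] := Ppart_partition E.
have [e eC] : exists e : E, e \in val C.
  by apply/set0Pn; apply: contraNneq n0 => <-; apply: (valP C).
by exists e; apply: val_inj; apply/esym/def_pblock => //; apply: valP.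
Qed.

Definition vertex_label (C : vertex QE) : vertex Q :=
  angle_vertex (projT1 (cid (Pvertex_surj C)) : monomial_angle monI).

Lemma vertex_labelE e : vertex_label (Pvertex (e : E)) = angle_vertex e.
Proof.
rewrite /vertex_label; case: cid => h /= /(congr1 val) eh.
by apply/(pblock_preim (@angle_vertex k Q I monI))/esym.
Qed.

Lemma vertex_label_inj : injective vertex_label.
Proof.
move=> C D; have [e ->] := Pvertex_surj C; have [h ->] := Pvertex_surj D.
by rewrite !vertex_labelE => eh; apply: val_inj; apply/pblock_preim.
Qed.

Definition turn_seq e n : seq (arrow QE) :=
  [seq (Larrow (e +> i : E) : arrow QE) | i <- iota 0 n].

Lemma turn_seqS e n : turn_seq e n.+1 = rcons (turn_seq e n) (Larrow (e +> n : E)).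
Proof. by rewrite /turn_seq -addn1 iotaD map_cat cats1. Qed.

Lemma size_turn_seq e n : size (turn_seq e n) = n.
Proof. by rewrite size_map size_iota. Qed.

Lemma turn_seq_labels e n :
  map arrow_label (turn_seq e n) = [seq angle_label (e +> i) | i <- iota 0 n].
Proof. by rewrite -map_comp; apply: eq_map => i /=; rewrite arrow_labelE. Qed.

Lemma turn_seq_before_end e n : before_end e n ->
  map arrow_label (turn_seq e n) = [seq inl a | a <- angle_word e n].
Proof. by move=> le; rewrite turn_seq_labels angle_word_labels. Qed.

Lemma turn_seq_eq_before_end e h n : before_end e n -> before_end h n ->
  angle_word e n = angle_word h n -> turn_seq e n = turn_seq h n.
Proof.
move=> be bh eh; apply: (inj_map arrow_label_inj).
by rewrite !turn_seq_before_end // eh.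
Qed.

(** A last angle is alone in its class, so its place in a word determines the
    angle from which the word is spelled. *)
Lemma turn_seq_end e h n i : turn_seq e n = turn_seq h n -> i < n ->
  angle_pos (e +> i) = plen (angle_path e) -> e = h.
Proof.
move=> eh lt epos; apply: (perm_inj (s := (monomial_rot monI ^+ i)%g)).
have := congr1 (fun s => nth (Larrow (e : E)) s i) eh.
rewrite !(nth_map 0) ?size_iota // !nth_iota // => /(congr1 arrow_label).
rewrite !arrow_labelE !add0n angle_label_end ?turn_path //.
by move/esym/angle_label_inr => [].
Qed.

Lemma turn_seq_wrap e h n : ~~ before_end e n -> turn_seq e n = turn_seq h n -> e = h.
Proof.
rewrite /before_end -ltnNge => lt eh.
pose i := plen (angle_path e) - angle_pos e.
have ei : angle_pos e + i = plen (angle_path e) by rewrite subnKC ?angle_pos_le.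
apply: (turn_seq_end (i := i) eh); first by rewrite -ei ltn_add2l in lt.
by rewrite turn_pos_small // /before_end ei.
Qed.

Lemma turn_seq_end_vertex e n :
  word_end (Pvertex (e : E) : vertex QE) (turn_seq e n) = Pvertex (e +> n : E).
Proof.
elim: n => [|n IH]; first by rewrite perm1.
rewrite turn_seqS word_end_rcons [LHS]fbc_tgtE; congr Pvertex.
by rewrite expgSr permM.
Qed.

Lemma turn_seq_composable e n : composable (Pvertex (e : E) : vertex QE) (turn_seq e n).
Proof.
elim: n => [|n IH] //; rewrite turn_seqS -cats1 composable_cat IH /= andbT.
apply/eqP/esym; rewrite [RHS]fbc_srcE; exact: turn_seq_end_vertex.
Qed.

(** For [n = 0] the two sides differ: the empty product is the sum of all
    trivial paths rather than one of them. *)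
Lemma Lword_elt n (f : nat -> E) : 0 < n ->
  Lword k n f =
  word_elt k (Pvertex (f 0) : vertex QE) [seq (Larrow (f i) : arrow QE) | i <- iota 0 n].
Proof.
case: n => // n _; rewrite /Lword; elim: n => [|n IH].
  rewrite big_ord1 arrow_eltE /=; congr word_elt; exact: fbc_srcE.
rewrite big_ord_recl -[X in iota _ X]addn1 iotaD map_cat cats1 -arrow_eltMl -IH.
by congr (_ * _)%R; rewrite /= subn1.
Qed.

Lemma Lrotword_elt n e : 0 < n ->
  Lrotword k n (e : E) = word_elt k (Pvertex (e : E) : vertex QE) (turn_seq e n).
Proof. by move=> n0; rewrite /Lrotword Lword_elt // perm1. Qed.

End Angles.

(** * Images of words in the trivial extension *)

Lemma sum_seq_single (V : nmodType) (J : eqType) (s : seq J) (j : J) (F : J -> V) :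
  uniq s -> j \in s -> (forall i, i \in s -> i != j -> F i = 0) ->
  \sum_(i <- s) F i = F j.
Proof.
move=> us js F0; rewrite (bigD1_seq _ js us) /= big1_seq ?addr0 // => i.
by case/andP=> ij is_; apply: F0.
Qed.

Section TrivialExtensionPairs.
Variables (k : fieldType) (A : pzAlgType k).
Local Notation T := (trivial_ext A).
Implicit Types (a b : A) (f h : dual A).

Lemma dual_fun0 f : f 0 = 0.
Proof. by rewrite -(scale0r 0) dualZ scale0r. Qed.

Lemma dual_mulZ f (c : k) a : f (c *: a) = (c * f a : k).
Proof. exact: dualZ. Qed.

Lemma dual_scale_mulE (c : k) f a : (c *: f) a = (c * f a : k).
Proof. by []. Qed.

Definition triv a f : T := (a, f).

Lemma triv_eta (x : T) : x = triv x.1 x.2.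
Proof. by case: x. Qed.

Lemma trivD a b f h : triv a f + triv b h = triv (a + b) (f + h).
Proof. by []. Qed.

Lemma trivZ c a f : c *: triv a f = triv (c *: a) (c *: f).
Proof. by []. Qed.

Lemma triv_lincomb (c d : k) a f : c *: triv a 0 + d *: triv 0 f = triv (c *: a) (d *: f).
Proof. by rewrite !trivZ trivD !scaler0 addr0 add0r. Qed.

Lemma dual_act0 a b : dual_act a (0 : dual A) b = 0.
Proof. by apply: dualP => x. Qed.

Lemma triv_mul_aa a b : triv a 0 * triv b 0 = triv (a * b) 0.
Proof. by rewrite [LHS]/(triv (a * b) (_ + _)) !dual_act0 addr0. Qed.

Lemma triv_mul_ad a f : triv a 0 * triv 0 f = triv 0 (dual_act a f 1).
Proof. by rewrite [LHS]/(triv (a * 0) (_ + _)) mulr0 !dual_act0 addr0. Qed.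

Lemma triv_mul_da f a : triv 0 f * triv a 0 = triv 0 (dual_act 1 f a).
Proof. by rewrite [LHS]/(triv (0 * a) (_ + _)) mul0r !dual_act0 add0r. Qed.

Lemma triv_mul_dd f h : triv 0 f * triv 0 h = 0.
Proof.
rewrite [LHS]/(triv (0 * 0) (_ + _)) mul0r; congr pair; apply: dualP => x.
by rewrite dual_addE !dual_actE mulr0 !mul0r !dual_fun0 addr0.
Qed.

End TrivialExtensionPairs.

Section Isomorphism.
Variables (k : fieldType) (Q : quiver) (I : ideal (path_alg k Q)).
Variable monI : monomial_ideal I.
Local Notation E := (monomial_fBC monI).
Local Notation QE := (fbc_quiver E).
Local Notation A := (quot_alg I).
Local Notation T := (trivial_ext A).
Local Notation pi := (quot_proj I).
Local Notation angle_path := (@angle_path k Q I monI).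
Local Notation "e +> n" := ((monomial_rot monI ^+ n)%g e)
  (at level 50, left associativity).
Implicit Types (e h : monomial_angle monI) (n m i : nat).

Definition path_triv v s : T := triv (pi (word_elt k v s)) 0.
Definition dual_triv v s : T := triv 0 (word_dual monI v s).

Definition vertex_img (C : vertex QE) : T := path_triv (vertex_label C) [::].

Definition arrow_img (C : arrow QE) : T :=
  match arrow_label C with
  | inl a => triv (pi (arrow_elt k a)) 0
  | inr x => dual_triv (psrc (angle_path x)) (parrows (angle_path x))
  end.

Lemma arrow_img_path a v s :
  triv (pi (arrow_elt k a)) 0 * path_triv v s = path_triv v (rcons s a).
Proof. by rewrite triv_mul_aa -quot_projM arrow_eltMl. Qed.

Lemma vertex_imgM C D :
  vertex_img C * vertex_img D = if C == D then vertex_img D else 0.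
Proof.
rewrite triv_mul_aa -quot_projM word_eltM /= eq_sym (inj_eq (@vertex_label_inj _ _ _ _)).
by case: eqP => // _; rewrite rmorph0.
Qed.

Lemma vertex_img_arrow C D : vertex_img C * arrow_img D =
  if C == arrow_tgt D then arrow_img D else 0.
Proof.
rewrite -(Larrow_repr D); set e := fbc_repr D.
have -> : arrow_tgt (Larrow e : arrow QE) = Pvertex (e +> 1 : E).
  by rewrite [LHS]fbc_tgtE.
rewrite -(inj_eq (@vertex_label_inj _ _ _ monI)) vertex_labelE.
rewrite /arrow_img arrow_labelE turnS perm1.
case el: (angle_label e) => [a|x].
  rewrite triv_mul_aa -quot_projM arrow_eltE word_eltM /= /word_end /=.
  by rewrite (angle_label_tgt el) eq_sym; case: eqP => // _; rewrite rmorph0.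
have [-> epos] := angle_label_inr el.
rewrite triv_mul_ad.
have -> : angle_vertex (angle_next e) = psrc (angle_path e).
  rewrite angle_vertexE -[angle_pos _]/((angle_pos e).+1 %% _)%N epos modnn take0.
  by [].
set v := psrc _; set p := parrows _.
have [vC|nvC] := eqVneq; last first.
  rewrite /dual_triv; congr triv; apply: dualP => z; rewrite dual_actE mul1r.
  by have [[u [_ /esym/eqP]]|->//] := word_dual_mulr monI v p (vertex_label C) [::];
    rewrite (negbTE nvC).
rewrite /dual_triv; congr triv; apply: dualP => z; rewrite dual_actE mul1r vC.
have := @word_dual_catr k Q I monI v [::] p z; apply; exact: psrc_arrows_nonzero.
Qed.

(** Every vertex lies on a maximal path, since its trivial path is nonzero, so
    the vertices of the configuration are those of [Q]. *)
Lemma vertex_img_sum : \sum_C vertex_img C = 1.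
Proof.
have trivS (r : seq (vertex QE)) F : \sum_(C <- r) triv (F C) (0 : dual A) =
    triv (\sum_(C <- r) F C) 0.
  elim: r => [|C r IH]; rewrite ?big_nil // !big_cons IH trivD addr0 //.
rewrite trivS; congr pair.
have piS (J : finType) (F : J -> path_alg k Q) :
    \sum_i pi (F i) = pi (\sum_i F i) by rewrite rmorph_sum.
have [g gK Kg] : bijective (@vertex_label k Q I monI).
  apply: inj_card_bij; first exact: vertex_label_inj.
  rewrite -(card_codom (@vertex_label_inj _ _ _ monI)); apply/subset_leq_card.
  apply/fintype.subsetP => v _; apply/codomP.
  have [|e [ev _ _]] := @nonzero_word_angle k Q I monI v [::].
    exact: nonzero_word_nil.
  by exists (Pvertex (e : E)); rewrite vertex_labelE.
transitivity (\sum_v pi (word_elt k v [::])).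
  rewrite [RHS](reindex (@vertex_label k Q I monI)) //.
  by exists g => C _.
by rewrite piS -path_alg1.
Qed.

(** The basis element attached to a word of at most one full turn: the path
    that it spells, or the dual of the piece that it misses. *)
Definition turn_triv e n : T :=
  if before_end e n then path_triv (angle_vertex e) (angle_word e n)
  else dual_triv (angle_vertex (e +> n)) (angle_word (e +> n) (angle_deg e - n)).

Lemma dual_triv_arrow_path x v s u : parrows (angle_path x) = u ++ s ->
  word_end (psrc (angle_path x)) u = v ->
  dual_triv (psrc (angle_path x)) (parrows (angle_path x)) * path_triv v s =
  dual_triv (psrc (angle_path x)) u.
Proof.
move=> pE pv; rewrite triv_mul_da; congr triv; apply: dualP => z.
rewrite dual_actE mulr1 pE -pv word_dual_catl // -pE.
exact: psrc_arrows_nonzero.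
Qed.

(** One letter is added at a time. An arrow of [Q] prolongs a path or shortens
    the missing piece from its beginning; the extra arrow of [p] turns a final
    piece of [p] into the dual of the initial piece that it misses. *)
Lemma turn_triv_step e n : (n < angle_deg e)%N ->
  arrow_img (Larrow (e +> n : E)) * turn_triv e n = turn_triv e n.+1.
Proof.
move=> lt; rewrite /turn_triv /arrow_img arrow_labelE.
have [be|wr] := boolP (before_end e n).
  case el: (angle_label (e +> n)) => [a|x].
    have -> : before_end e n.+1.
      rewrite /before_end addnS ltn_neqAle [X in _ && X]be andbT.
      apply/eqP => pe; move: el; rewrite angle_label_end //.
      by rewrite turn_pos_small // turn_path.
    by rewrite arrow_img_path -(angle_word_rcons be el).
  have [-> epos] := angle_label_inr el.
  rewrite turn_path turn_pos_small // in epos.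
  rewrite /before_end addnS -epos ltnn.
  have wE : parrows (angle_path e) =
      take (angle_pos e) (parrows (angle_path e)) ++ angle_word e n.
    rewrite -[LHS](cat_take_drop (angle_pos e)) /angle_word; congr (_ ++ _).
    by rewrite take_oversize // size_drop leq_subLR epos.
  rewrite (dual_triv_arrow_path (u := take (angle_pos e) (parrows (angle_path e)))).
  - have p0 : angle_pos (e +> n.+1) = 0.
      by rewrite turn_pos addnS epos modnn.
    rewrite angle_vertexE /angle_word p0 take0 drop0 !turn_path.
    by rewrite /angle_deg -epos subSS addnK.
  - by rewrite turn_path.
  - by rewrite turn_path angle_vertexE.
have pw := turn_pos_wrap (ltnW lt) wr.
have wb := wrap_before_end (ltnW lt) wr.
have -> : before_end e n.+1 = false.
  by apply/negbTE; move: wr; rewrite /before_end -!ltnNge addnS => /ltnW.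
have mE : (angle_deg e - n = (angle_deg e - n.+1).+1)%N by rewrite subnSK.
have [a el] : exists a, angle_label (e +> n) = inl a.
  apply: angle_label_inl; apply: leq_trans wb; rewrite mE.
  by rewrite addnS ltnS leq_addr.
have tE : e +> n +> 1 = e +> n.+1 by rewrite turnD addn1.
have wc : angle_word (e +> n) (angle_deg e - n) =
    [:: a] ++ angle_word (e +> n.+1) (angle_deg e - n.+1).
  by rewrite mE (angle_word_cons _ el) tE.
rewrite el triv_mul_ad wc; congr triv; apply: dualP => z; rewrite dual_actE mul1r.
rewrite arrow_eltE (angle_label_src el) word_dual_catr.
  by rewrite /word_end /= (angle_label_tgt el) turnS.
by rewrite -wc; apply: angle_word_nonzero.
Qed.

Local Notation word_img := (word_val vertex_img arrow_img).

Lemma word_img_turn e n : (n <= angle_deg e)%N ->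
  word_img (Pvertex (e : E)) (turn_seq e n) = turn_triv e n.
Proof.
elim: n => [_|n IH lt].
  rewrite /turn_triv /before_end addn0 angle_pos_le /angle_word take0.
  by rewrite [LHS]/(path_triv _ _) vertex_labelE.
by rewrite turn_seqS word_val_rcons IH ?(ltnW lt) // turn_triv_step.
Qed.

(** The image of a shorter word is zero, a path, or a dual path, and in the
    last two cases a further letter with nonzero product has no choice: it must
    make the path longer within some maximal path, close a maximal path with its
    own extra arrow, or cancel the first arrow of the missing piece. *)
Lemma word_img_standard_or0 C s :
  (exists e n, [/\ (n <= angle_deg e)%N, C = Pvertex (e : E) & s = turn_seq e n]) \/
  word_img C s = 0.
Proof.
elim/last_ind: s => [|s B [[e [n [le -> ->]]]|s0]]; last 1 first.
- by right; rewrite word_val_rcons s0 mulr0.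
- by left; have [e ->] := Pvertex_surj C; exists e, 0%N.
rewrite word_val_rcons word_img_turn // /turn_triv.
have stepP h : angle_vertex h = angle_vertex e -> (n < angle_deg h)%N ->
    map (@arrow_label k Q I monI) (turn_seq h n) =
      map (@arrow_label k Q I monI) (turn_seq e n) ->
    arrow_label B = angle_label (h +> n) ->
    exists (h : E) m, [/\ (m <= angle_deg h)%N, Pvertex (e : E) = Pvertex h
      & rcons (turn_seq e n) B = turn_seq h m].
  move=> vh lth eh eB; exists h, n.+1; split=> //.
    by apply: vertex_label_inj; rewrite !vertex_labelE.
  rewrite turn_seqS -(inj_map (@arrow_label_inj _ _ _ _) eh); congr rcons.
  by apply: arrow_label_inj; rewrite arrow_labelE.
have [be|wr] := boolP (before_end e n); rewrite /arrow_img.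
  case eB: (arrow_label B) => [a|x].
    rewrite arrow_img_path.
    (* The prolonged path may lie on another maximal path, so the angle changes
       although the letters do not. *)
    have [Iw|nz] := pselect (I (word_elt k (angle_vertex e)
        (rcons (angle_word e n) a))).
      by right; rewrite /path_triv (quot_proj_eq0 I _).2.
    left; have [h [hv hb hw]] := nonzero_word_angle monI nz.
    rewrite size_rcons size_angle_word // in hb hw.
    have hb' : before_end h n by apply: leq_trans hb; rewrite leq_add2l.
    have [b eb] : exists b, angle_label (h +> n) = inl b.
      by apply: angle_label_inl; rewrite turn_path turn_pos_small // -addnS.
    move: hw; rewrite (angle_word_rcons hb' eb) => /rcons_inj [hw ab].
    apply: (stepP h) => //.
    - by rewrite /angle_deg ltnS; apply: leq_trans hb'; apply: leq_addl.
    - by rewrite !turn_seq_before_end // hw.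
    - by rewrite eB eb ab.
  have [] := word_dual_mull monI (psrc (angle_path x)) (parrows (angle_path x))
    (angle_vertex e) (angle_word e n); last first.
    move=> z0; right; rewrite triv_mul_da; congr triv; apply: dualP => z.
    by rewrite dual_actE mulr1 z0.
  (* The angle must now sit on the maximal path closed by this arrow. *)
  case=> u [pE uv]; left; have [xe xpos] := angle_label_inr eB.
  have pE' : parrows (angle_path x) = u ++ angle_word e n ++ [::] by rewrite cats0.
  have [h [hp hpos hv hb hw]] := max_path_split pE'.
  rewrite size_angle_word // in hb hw.
  have hx : h +> n = x.
    apply: angle_eq; first by rewrite turn_path.
    rewrite turn_pos_small // hpos xe xpos -xe /plen pE size_cat size_angle_word //.
  apply: (stepP h).
  - by rewrite hv.
  - by rewrite /angle_deg ltnS; apply: leq_trans hb; apply: leq_addl.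
  - by rewrite !turn_seq_before_end // hw.
  - by rewrite hx xe.
case eB: (arrow_label B) => [a|x]; last by right; rewrite triv_mul_dd.
have [] := word_dual_mulr monI (angle_vertex (e +> n))
  (angle_word (e +> n) (angle_deg e - n)) (arrow_src a) [:: a]; last first.
  move=> z0; right; rewrite triv_mul_ad; congr triv; apply: dualP => z.
  by rewrite dual_actE mul1r arrow_eltE z0.
case=> u [wE _]; left; have wb := wrap_before_end le wr.
have sz := size_angle_word wb; rewrite wE /= in sz.
apply: (stepP e) => //; first by rewrite -subn_gt0 -sz.
have [b eb] : exists b, angle_label (e +> n) = inl b.
  apply: angle_label_inl; apply: leq_trans wb; rewrite -sz.
  by rewrite addnS ltnS leq_addr.
by move: wE; rewrite -sz (angle_word_cons _ eb) eB eb => -[->].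
Qed.

End Isomorphism.

(** * The inverse map and the isomorphism *)

Section Inverse.
Variables (k : fieldType) (Q : quiver) (I : ideal (path_alg k Q)).
Variable monI : monomial_ideal I.
Local Notation E := (monomial_fBC monI).
Local Notation QE := (fbc_quiver E).
Local Notation kQE := (path_alg k QE).
Local Notation A := (quot_alg I).
Local Notation T := (trivial_ext A).
Local Notation B := (fbc_alg E k).
Local Notation pi := (quot_proj I).
Local Notation rho := (quot_proj (fbc_ideal E k)).
Local Notation angle_path := (@angle_path k Q I monI).
Local Notation "e +> n" := ((monomial_rot monI ^+ n)%g e)
  (at level 50, left associativity).
Local Notation path_img := (path_lift (@vertex_img k Q I monI) (@arrow_img k Q I monI)).
Implicit Types (e h : monomial_angle monI) (n m i : nat).

Definition turn_elt e n : kQE := word_elt k (Pvertex (e : E) : vertex QE) (turn_seq e n).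

Lemma addn_subS i n : (i < n)%N -> (i + (n - i.+1) = n.-1)%N.
Proof. by move=> lt; rewrite -[in RHS](subnKC lt) addSn. Qed.

Lemma path_imgM x y : path_img (x * y) = path_img x * path_img y.
Proof. by apply: path_liftM; [exact: vertex_imgM|exact: vertex_img_arrow]. Qed.

Lemma path_img1 : path_img 1 = 1.
Proof. by apply: path_lift1; exact: vertex_img_sum. Qed.

Lemma path_img_turn e n : (n <= angle_deg e)%N ->
  path_img (turn_elt e n) = turn_triv e n.
Proof.
by move=> le; rewrite path_lift_word ?turn_seq_composable // word_img_turn.
Qed.

(** The words passing a last position are those completing the turn after a
    word that does not. *)
Lemma before_end_complement e m : before_end e m ->
  [/\ (m < angle_deg e)%N, ~~ before_end (e +> m) (angle_deg e - m),
      e +> m +> (angle_deg e - m) = e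
    & angle_deg (e +> m) - (angle_deg e - m) = m]%N.
Proof.
move=> be; have lt : (m < angle_deg e)%N.
  by rewrite /angle_deg ltnS; apply: leq_trans be; apply: leq_addl.
split=> //.
- rewrite /before_end turn_path turn_pos_small // -ltnNge -addnA subnKC ?(ltnW lt) //.
  by rewrite /angle_deg addnS ltnS leq_addl.
- by rewrite turnD subnKC ?(ltnW lt) // monomial_rot_deg.
- by rewrite turn_deg subKn // ltnW.
Qed.

Lemma turn_triv_complement e m : before_end e m ->
  turn_triv (e +> m) (angle_deg e - m) = dual_triv monI (angle_vertex e) (angle_word e m).
Proof.
by case/before_end_complement=> _ nb back dm; rewrite /turn_triv (negbTE nb) back dm.
Qed.

Lemma turn_triv_complement_eq e h m : before_end e m -> before_end h m ->
  angle_vertex e = angle_vertex h -> turn_seq e m = turn_seq h m ->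
  turn_triv (e +> m) (angle_deg e - m) = turn_triv (h +> m) (angle_deg h - m).
Proof.
move=> be bh vE sE; rewrite !turn_triv_complement // vE; congr (dual_triv _ _ _).
have : map (@inl _ (monomial_angle monI)) (angle_word e m) = map inl (angle_word h m).
  by rewrite -!turn_seq_before_end // sE.
by apply: inj_map => a b [].
Qed.

Lemma path_img_relation z : fbc_relation z -> path_img z = 0.
Proof.
case=> [e h j Peh je jh Lj|n f n0 _ cap0|e n dn].
- change (is_true (j < angle_deg e)%N) in je.
  change (is_true (j < angle_deg h)%N) in jh.
  change (forall i, (0 < i <= j)%N -> Lcls (e +> (angle_deg e - i) : E) =
    Lcls (h +> (angle_deg h - i) : E)) in Lj.
  rewrite -[deg e]/(angle_deg e) -[deg h]/(angle_deg h).
  rewrite !Lrotword_elt ?subn_gt0 //.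
  (* The [j] letters compared by (R1) are those spelled from [e'] and [h'], and
     they lead back to [e] and [h]. *)
  pose e' := e +> (angle_deg e - j); pose h' := h +> (angle_deg h - j).
  have e'E : e = e' +> j by rewrite turnD subnK ?(ltnW je) // monomial_rot_deg.
  have h'E : h = h' +> j by rewrite turnD subnK ?(ltnW jh) // monomial_rot_deg.
  have seq_eq : turn_seq e' j = turn_seq h' j.
    apply/eq_in_map => i; rewrite mem_iota add0n => /andP[_ ij].
    apply: val_inj; have ji : (0 < j - i <= j)%N by rewrite subn_gt0 ij leq_subr.
    have := Lj _ ji; rewrite !subnBA ?(ltnW ij) //.
    by rewrite -!addnBAC ?(ltnW je) ?(ltnW jh) // -!turnD.
  have v_eq : angle_vertex e' = angle_vertex h'.
    case: (posnP j) => [j0|jpos].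
      rewrite /e' /h' j0 !subn0 !monomial_rot_deg.
      exact/(pblock_preim (@angle_vertex k Q I monI)).
    have := Lj j; rewrite jpos leqnn => /(_ isT).
    by case/(pblock_preim (@angle_label k Q I monI))/angle_label_vertex.
  rewrite path_liftB -!/(turn_elt _ _) !path_img_turn ?leq_subr //.
  have ed : angle_deg e = angle_deg e' by rewrite turn_deg.
  have hd : angle_deg h = angle_deg h' by rewrite turn_deg.
  rewrite ed hd e'E h'E; apply/eqP; rewrite subr_eq0; apply/eqP.
  have [be|/turn_seq_wrap/(_ seq_eq) -> //] := boolP (before_end e' j).
  have [bh|/turn_seq_wrap/(_ (esym seq_eq)) -> //] := boolP (before_end h' j).
  exact: turn_triv_complement_eq.
- rewrite Lword_elt //; set C : vertex QE := Pvertex _.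
  set s : seq (arrow QE) := map _ _.
  have [cs|/word_elt_ncomp ->] := boolP (composable C s); last exact: path_lift0.
  rewrite path_lift_word //.
  have [[e [m [_ _ sE]]]|//] := word_img_standard_or0 C s.
  (* The angle [g^(n-1)(e)] would lie in the empty intersection. *)
  have mn : m = n by rewrite -(size_turn_seq e m) -sE size_map size_iota.
  have : e +> n.-1 \in (finset.set0 : {set monomial_angle monI}).
    rewrite -[finset.set0]cap0; apply/bigcapP => i _; apply/imsetP; exists (e +> i).
      have := congr1 (fun s => nth (Larrow (e : E)) s i) sE.
      rewrite mn !(nth_map 0%N) ?size_iota // !nth_iota // => /(congr1 val) /= ->.
      by rewrite mem_pblock (cover_partition (Lpart_partition E)) inE.
    by rewrite turnD addn_subS.
  by rewrite inE.
- change (is_true (angle_deg e < n)%N) in dn.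
  rewrite Lrotword_elt; last exact: leq_ltn_trans dn.
  rewrite path_lift_word ?turn_seq_composable //.
  have [[h [m [mh _ sE]]]|//] := word_img_standard_or0 (Pvertex (e : E)) (turn_seq e n).
  have mn : m = n by rewrite -(size_turn_seq h m) -sE size_turn_seq.
  have wr : ~~ before_end e n.
    rewrite /before_end -ltnNge; apply: leq_trans (leq_addl _ _).
    by apply: leq_trans (ltnW dn).
  rewrite mn in sE mh; have eh := turn_seq_wrap wr sE.
  by move: dn; rewrite eh ltnNge mh.
Qed.

Lemma path_img_ideal z : fbc_ideal E k z -> path_img z = 0.
Proof.
move=> Iz; apply: (Iz (fun z => path_img z = 0)).
split; last exact: path_img_relation.
split=> [|x y x0 y0|a x b x0]; first exact: path_lift0.
  by rewrite path_liftD x0 y0 addr0.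
by rewrite !path_imgM x0 mulr0 mul0r.
Qed.

(** This is (R1) with [j = m], its [j] letters being the missing piece. *)
Lemma turn_elt_complement_eq e h m : before_end e m -> before_end h m ->
  angle_vertex e = angle_vertex h -> angle_word e m = angle_word h m ->
  rho (turn_elt (e +> m) (angle_deg e - m)) = rho (turn_elt (h +> m) (angle_deg h - m)).
Proof.
move=> be bh vE wE; have sE := turn_seq_eq_before_end be bh wE.
have [ltd _ _ _] := before_end_complement be.
have [lhd _ _ _] := before_end_complement bh.
apply/quot_projP; apply: mem_gen_ideal.
have eltE x n : (0 < n)%N -> turn_elt x n = Lrotword k n (x : E).
  by move=> n0; rewrite Lrotword_elt.
rewrite !eltE ?subn_gt0 //.
have := @FBC_R1 E k (e +> m) (h +> m) m.
rewrite -[deg (e +> m : E)]/(angle_deg _) -[deg (h +> m : E)]/(angle_deg _) !turn_deg.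
apply=> //.
- have vv : Pvertex (e : E) = Pvertex (h : E).
    by apply: (@vertex_label_inj _ _ _ monI); rewrite !vertex_labelE.
  have := congr1 (word_end (Pvertex (e : E) : vertex QE)) sE.
  by rewrite [in RHS]vv !turn_seq_end_vertex => /(congr1 val).
- move=> i /andP[i0 im].
  have lt : (m - i < m)%N by rewrite ltn_subrL i0 (leq_trans i0 im).
  have := congr1 (fun s => nth (Larrow (e : E)) s (m - i)) sE.
  rewrite !(nth_map 0%N) ?size_iota // !nth_iota // !add0n => /(congr1 val) /=.
  have back x : (m < angle_deg x)%N -> x +> m +> (angle_deg x - i) = x +> (m - i).
    move=> lx; rewrite turnD addnBA ?(leq_trans im (ltnW lx)) // addnC -addnBA //.
    by rewrite -turnD monomial_rot_deg.
  by rewrite !back.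
Qed.

Lemma composable_nth (C : arrow QE) v s i : composable v s -> (i.+1 < size s)%N ->
  arrow_tgt (nth C s i) = arrow_src (nth C s i.+1).
Proof.
elim: s v i => // a [//|b s] IH v [|i] /andP[_ cs] lt; last exact: IH cs lt.
by case/andP: cs => /eqP.
Qed.

(** A word that is spelled from an angle, but through more than one full turn,
    is killed by (R3). If it is spelled from no angle, then (R2) applies to
    arbitrary representatives of its letters: an element of the intersection,
    turned back, would be an angle spelling the word. *)
Lemma nonstandard_word_ideal (v : vertex QE) (s : seq (arrow QE)) : composable v s ->
  ~ (exists e n, [/\ (n <= angle_deg e)%N, v = Pvertex (e : E) & s = turn_seq e n]) ->
  fbc_ideal E k (word_elt k v s).
Proof.
move=> cs nstd; have s0 : (0 < size s)%N.
  case: s cs nstd => // _ []; have [e ve] := Pvertex_surj v.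
  by exists e, 0%N.
have [C CE] : exists C, C = nth C s 0 by case: s {cs nstd} s0 => // C s _; exists C.
have vC : v = fbc_src C.
  by rewrite CE; case: s s0 cs {nstd CE} => //= D s _ /andP[/eqP].
have [[e sE]|nturn] := pselect (exists e, s = turn_seq e (size s)).
  have ve : v = Pvertex (e : E).
    rewrite vC CE sE -(prednK s0) /= perm1; exact: (@fbc_srcE E e).
  rewrite sE ve -Lrotword_elt //; apply: mem_gen_ideal; apply: FBC_R3.
  rewrite -[deg (e : E)]/(angle_deg e) ltnNge; apply/negP => le.
  by apply: nstd; exists e, (size s).
pose f i : E := fbc_repr (nth C s i).
have sE : s = [seq (Larrow (f i) : arrow QE) | i <- iota 0 (size s)].
  rewrite -[LHS](mkseq_nth C); apply: eq_map => i; exact/esym/Larrow_repr.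
have -> : word_elt k v s = Lword k (size s) f.
  by rewrite Lword_elt // -sE vC CE.
apply: mem_gen_ideal; apply: FBC_R2 => // [i lt|].
  exact: (congr1 val (composable_nth C cs lt)).
apply/eqP; rewrite -finset.subset0; apply/fintype.subsetP => y /bigcapP cap.
have [e ey] : exists e, e +> (size s).-1 = y.
  by exists ((monomial_rot monI ^- (size s).-1)%g y); rewrite permKV.
case: nturn; exists e.
rewrite [LHS]sE; apply/eq_in_map => i.
rewrite mem_iota add0n => /andP[_ lt]; have /imsetP[x xf yx] := cap (Ordinal lt) isT.
have -> : e +> i = x.
  apply: (perm_inj (s := (monomial_rot monI ^+ (size s - i.+1))%g)).
  by rewrite turnD -[RHS]yx addn_subS.
apply: val_inj; have /and3P[_ tI _] := Lpart_partition E.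
exact/esym/(same_pblock tI xf).
Qed.

(** [W] chooses, for each nonzero path [x], a word spelling [x] and a word
    missing [x], both read along the same occurrence of [x] on a maximal
    path. *)
Definition path_coding (W : qpath Q -> kQE * kQE) : Prop :=
  forall p, nonzero_word I (psrc p) (parrows p) ->
  exists e, [/\ angle_vertex e = psrc p, before_end e (plen p),
    angle_word e (plen p) = parrows p
    & W p = (turn_elt e (plen p), turn_elt (e +> plen p) (angle_deg e - plen p))].

Lemma path_coding_exists : exists W, path_coding W.
Proof.
suff /choice[W WP] : forall p, exists x : kQE * kQE,
    nonzero_word I (psrc p) (parrows p) -> exists e,
    [/\ angle_vertex e = psrc p, before_end e (plen p),
      angle_word e (plen p) = parrows p
      & x = (turn_elt e (plen p), turn_elt (e +> plen p) (angle_deg e - plen p))].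
  by exists W.
move=> p.
have [/(nonzero_word_angle monI)[e [ev be ew]]|z] :=
  pselect (nonzero_word I (psrc p) (parrows p)).
  by eexists=> _; exists e.
by exists (0, 0).
Qed.

Section Coding.
Variables (r : seq (qpath Q)) (W : qpath Q -> kQE * kQE).
Hypotheses (r_uniq : uniq r)
  (mem_r : forall p, (p \in r) = `[< nonzero_word I (psrc p) (parrows p) >])
  (codeW : path_coding W).

Definition decode (x : T) : B :=
  \sum_(p <- r) (word_dual monI (psrc p) (parrows p) x.1 *: rho (W p).1 +
                 x.2 (pi (path_elt k p)) *: rho (W p).2).

Lemma decodeD x y : decode (x + y) = decode x + decode y.
Proof.
rewrite -big_split; apply: eq_bigr => p _.
rewrite [(x + y).1]/(x.1 + y.1) [(x + y).2]/(x.2 + y.2) dualD dual_addE.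
by rewrite !scalerDl addrACA.
Qed.

Lemma decodeZ c x : decode (c *: x) = c *: decode x.
Proof.
rewrite scaler_sumr; apply: eq_bigr => p _.
rewrite [(c *: x).1]/(c *: x.1) [(c *: x).2]/(c *: x.2) dual_mulZ dual_scale_mulE.
by rewrite scalerDr -!scalerA.
Qed.

Lemma decode0 : decode 0 = 0.
Proof. by rewrite -(scale0r (0 : T)) decodeZ scale0r. Qed.

Lemma word_dual_path p q : p \in r -> q \in r ->
  word_dual monI (psrc p) (parrows p) (pi (path_elt k q)) = (q == p)%:R.
Proof.
rewrite mem_r => /asboolP pnz _; rewrite word_dualE // -word_elt_path word_coefE.
by rewrite (nonzero_word_comp pnz) -!surjective_pairing.
Qed.

Lemma decode_triv (a : A) (f : dual A) : decode (triv a f) =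
  \sum_(p <- r) (word_dual monI (psrc p) (parrows p) a *: rho (W p).1 +
                 f (pi (path_elt k p)) *: rho (W p).2).
Proof. by []. Qed.

Lemma decode_path p : p \in r ->
  decode (path_triv I (psrc p) (parrows p)) = rho (W p).1.
Proof.
move=> pr; rewrite [LHS]decode_triv word_elt_path.
rewrite (sum_seq_single r_uniq pr) => [|q qr qp].
  by rewrite word_dual_path // eqxx scale1r scale0r addr0.
by rewrite word_dual_path // eq_sym (negbTE qp) !scale0r addr0.
Qed.

Lemma decode_dual p : p \in r ->
  decode (dual_triv monI (psrc p) (parrows p)) = rho (W p).2.
Proof.
move=> pr; rewrite [LHS]decode_triv.
rewrite (sum_seq_single r_uniq pr) => [|q qr qp].
  by rewrite word_dual_path // eqxx dual_fun0 scale1r scale0r add0r.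
by rewrite word_dual_path // (negbTE qp) dual_fun0 !scale0r addr0.
Qed.

Lemma path_img_code p : p \in r ->
  path_img (W p).1 = path_triv I (psrc p) (parrows p) /\
  path_img (W p).2 = dual_triv monI (psrc p) (parrows p).
Proof.
rewrite mem_r => /asboolP /codeW [e [ev be ew ->]] /=.
have [lt _ _ _] := before_end_complement be.
rewrite !path_img_turn ?(ltnW lt) ?turn_deg ?leq_subr // turn_triv_complement //.
by rewrite /turn_triv be ev ew.
Qed.

(** The word chosen for a basis element need not be the given one; it agrees
    with it letter by letter, or up to (R1). *)
Lemma decode_turn e n : (n <= angle_deg e)%N ->
  decode (turn_triv e n) = rho (turn_elt e n).
Proof.
move=> le; rewrite /turn_triv.
have key h m : before_end h m -> exists p, [/\ p \in r, psrc p = angle_vertex h,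
    parrows p = angle_word h m & plen p = m].
  move=> bh; have nz := @angle_word_nonzero k Q I monI h m.
  exists (QPath (qpath_val := (_, _)) (nonzero_word_comp nz)).
  split=> //; last exact: size_angle_word.
  by rewrite mem_r; apply/asboolP.
case: ifPn => [be|nb].
  have [p [pr pv pw pl]] := key _ _ be.
  rewrite -pv -pw decode_path //; congr rho.
  move: (pr); rewrite mem_r => /asboolP /codeW [h [hv hb hw ->]] /=.
  rewrite pl pw pv in hv hb hw *; rewrite /turn_elt.
  rewrite (turn_seq_eq_before_end hb be hw); congr word_elt.
  by apply: (@vertex_label_inj _ _ _ monI); rewrite !vertex_labelE.
have wb := wrap_before_end le nb; set h := e +> n in wb *; set m := (_ - n)%N in wb *.
have [p [pr pv pw pl]] := key _ _ wb.
rewrite -pv -pw decode_dual //.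
move: (pr); rewrite mem_r => /asboolP /codeW [x [xv xb xw ->]] /=.
rewrite pl pw pv in xv xb xw *; rewrite (turn_elt_complement_eq xb wb xv xw).
rewrite /h /m turn_deg turnD subnKC // monomial_rot_deg subKn //.
Qed.

Lemma decode_img y : decode (path_img y) = rho y.
Proof.
elim/path_alg_ind: y => [|c v s y cs IH]; first by rewrite path_lift0 decode0 rmorph0.
rewrite path_liftD decodeD IH path_liftZ decodeZ quot_projD quot_projZ.
suff -> : decode (path_img (word_elt k v s)) = rho (word_elt k v s) by [].
have [[e [n [le vE sE]]]|nstd] := pselect (exists e n,
  [/\ (n <= angle_deg e)%N, v = Pvertex (e : E) & s = turn_seq e n]).
  by rewrite vE sE path_img_turn // decode_turn.
rewrite path_lift_word //; have [//|->] := word_img_standard_or0 v s.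
rewrite decode0; apply/esym/quot_proj_eq0; exact: nonstandard_word_ideal cs nstd.
Qed.

(** The choice of a representative is harmless by [encode_rho]. *)
Definition encode (u : B) : T := path_img (generic_quotient.repr u).

Lemma encode_rho y : encode (rho y) = path_img y.
Proof.
apply/eqP; rewrite -subr_eq0 -path_liftB; apply/eqP/path_img_ideal.
exact: repr_quot_pi.
Qed.

Lemma encodeK : cancel encode decode.
Proof.
by move=> u; have [y ->] := quot_proj_surj u; rewrite encode_rho decode_img.
Qed.

Lemma encodeD u v : encode (u + v) = encode u + encode v.
Proof.
have [x ->] := quot_proj_surj u; have [y ->] := quot_proj_surj v.
by rewrite -quot_projD !encode_rho path_liftD.
Qed.

Lemma encodeM u v : encode (u * v) = encode u * encode v.
Proof.
have [x ->] := quot_proj_surj u; have [y ->] := quot_proj_surj v.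
by rewrite -quot_projM !encode_rho path_imgM.
Qed.

Lemma encodeZ c u : encode (c *: u) = c *: encode u.
Proof.
have [x ->] := quot_proj_surj u.
by rewrite -quot_projZ !encode_rho path_liftZ.
Qed.

Lemma encode1 : encode 1 = 1.
Proof. by rewrite -[1 in LHS](rmorph1 rho) encode_rho path_img1. Qed.

Lemma encode0 : encode 0 = 0.
Proof. by rewrite -(scale0r (0 : B)) encodeZ scale0r. Qed.

Lemma decodeK : cancel decode encode.
Proof.
move=> x; rewrite /decode (big_morph encode encodeD encode0) [RHS]triv_eta.
rewrite {2}(quot_basisE monI r_uniq mem_r x.1) {2}(dual_basisE monI r_uniq mem_r x.2).
have trivS (s : seq (qpath Q)) F G : \sum_(p <- s) triv (F p) (G p) =
    triv (\sum_(p <- s) F p) (\sum_(p <- s) G p) :> T.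
  by elim: s => [|p s IH]; rewrite ?big_nil // !big_cons IH.
rewrite -trivS big_seq [RHS]big_seq; apply: eq_bigr => p pr.
have [e1 e2] := path_img_code pr.
have encZ c y : encode (c *: rho y) = c *: path_img y by rewrite encodeZ encode_rho.
rewrite encodeD [X in X + _ = _]encZ [X in _ + X = _]encZ.
by rewrite e1 e2 /path_triv word_elt_path triv_lincomb.
Qed.

End Coding.
End Inverse.

Theorem theorem4p4 (k : fieldType) (Q : quiver) (I : ideal (path_alg k Q))
    (monI : monomial_ideal I) :
  alg_isomorphic (fbc_alg (monomial_fsBC monI) k) (trivial_ext (quot_alg I)).
Proof.
have [r [r_uniq mem_r]] := nonzero_paths monI.
have [W codeW] := path_coding_exists monI.
pose f := @encode k Q I monI.
have fB : zmod_morphism f.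
  move=> u v; rewrite /f encodeD; congr (_ + _).
  by rewrite -[in LHS]scaleN1r encodeZ scaleN1r.
have fM : monoid_morphism f by split; [exact: encode1|exact: encodeM].
pose fzmod := GRing.isZmodMorphism.Build _ _ f fB.
pose fmon := GRing.isMonoidMorphism.Build _ _ f fM.
pose F : {rmorphism _ -> _} := HB.pack f fzmod fmon.
exists F; split; first by move=> c u; apply: encodeZ.
by exists (decode r W); [apply: encodeK|apply: decodeK].
Qed.
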